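(* Let $1<p<2$, let $d\ge 3$ be an integer, and let $p^\ast=p/(p-1)$. For real $q>2$ define $$f(q)=\max\bigl\{n\in\mathbb{Z},\ n\ge 2:\ 2(n-2)^q+(n-2)2^q\le (n-1)^q+n-1\bigr\}.$$ Then both $s(\ell_p^d)$ and $v(\ell_p^d)$ lie between $\min(d,f(p^\ast))$ and $\min(d+1,2^{p^\ast})$, i.e. $$\min(d,f(p^\ast))\le s(\ell_p^d)\le\min(d+1,2^{p^\ast})\quad\text{and}\quad \min(d,f(p^\ast))\le v(\ell_p^d)\le\min(d+1,2^{p^\ast}).$$ In particular, $f(q)\ge 3$ for $q>2$; $f(q)\ge 4$ for $q\ge 3.21067$; $f(q)\ge 5$ for $q\ge 3.40093$; and $f(q)\ge\lceil q/\log 2\rceil$ for $q\ge 3.69247$, where $\log$ is the natural logarithm.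
   Context: $\ell_p^d$ is $\mathbb{R}^d$ with the norm $\|(x_1,\dots,x_d)\|_p=\bigl(\sum_{i=1}^d|x_i|^p\bigr)^{1/p}$. Let $X$ be a finite-dimensional real normed space with norm $\|\cdot\|$. For a finite set $S\subseteq X$, a Steiner Minimal Tree (SMT) of $S$ is a finite tree $T$ whose vertex set $V(T)$ satisfies $S\subseteq V(T)\subseteq X$ and whose total length $\sum_{\{x,y\}\in E(T)}\|x-y\|$ is minimal among all finite trees with vertex set $V$ satisfying $S\subseteq V\subseteq X$. The elements of $S$ are called the vertices of the SMT, and the elements of $V(T)\setminus S$ its Steiner points. $v(X)$ denotes the largest degree (in $T$) of a vertex, i.e. an element of $S$, over all SMTs $T$ of finite sets $S$ in $X$; $s(X)$ denotes the largest degree of a Steiner point over all SMTs of finite sets in $X$. *)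

(* Defs.v *)
From HB Require Import structures.
From mathcomp Require Import all_boot all_order all_algebra finmap.
From mathcomp Require Import all_classical all_reals all_analysis.
From mathcomp Require Import ring.

Set Implicit Arguments.
Unset Strict Implicit.
Unset Printing Implicit Defensive.

Import Order.TTheory GRing.Theory Num.Theory.
Import numFieldNormedType.Exports.

Local Open Scope ring_scope.

Section PNorm.
Variables (R : realType) (p : R) (d : nat).
Hypothesis p1 : 1 <= p.

Definition pnorm (x : 'rV[R]_d) : R := (\sum_(i < d) `|x 0 i| `^ p) `^ p^-1.

Let p0 : 0 < p := lt_le_trans ltr01 p1.

Let sum_ge0 (x : 'rV[R]_d) : 0 <= \sum_(i < d) `|x 0 i| `^ p.
Proof. by apply: sumr_ge0 => i _; exact: powR_ge0. Qed.

Let pnorm_ge0 x : 0 <= pnorm x.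
Proof. exact: powR_ge0. Qed.

Let pnormX x : pnorm x `^ p = \sum_(i < d) `|x 0 i| `^ p.
Proof. by rewrite /pnorm -powRrM mulVf ?gt_eqF// powRr1. Qed.

Lemma pnormZ (l : R) (x : 'rV[R]_d) : pnorm (l *: x) = `|l| * pnorm x.
Proof.
rewrite /pnorm; under eq_bigr do rewrite mxE normrM powRM//.
by rewrite -mulr_sumr powRM ?powR_ge0// -powRrM mulfV ?gt_eqF// powRr1.
Qed.

Lemma pnorm0_eq0 (x : 'rV[R]_d) : pnorm x = 0 -> x = 0.
Proof.
move=> /powR_eq0_eq0 /eqP; rewrite psumr_eq0; last by move=> i _; exact: powR_ge0.
move=> /allP h; apply/rowP => i; rewrite mxE.
have /implyP/(_ isT)/eqP/powR_eq0_eq0 := h i (mem_index_enum i).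
exact: normr0_eq0.
Qed.

Lemma pnormD (x y : 'rV[R]_d) : pnorm (x + y) <= pnorm x + pnorm y.
Proof.
have [/eqP/pnorm0_eq0 ->|x0] := boolP (pnorm x == 0).
  by rewrite add0r lerDr.
have [/eqP/pnorm0_eq0 ->|y0] := boolP (pnorm y == 0).
  by rewrite addr0 lerDl.
have a0 : 0 < pnorm x by rewrite lt0r x0 pnorm_ge0.
have b0 : 0 < pnorm y by rewrite lt0r y0 pnorm_ge0.
rewrite [X in X <= _]/pnorm.
move: (pnormX x) (pnormX y) a0 b0.
move: (pnorm x) (pnorm y) => a b {x0 y0} aX bX a0 b0.
have ab0 : 0 < a + b := addr_gt0 a0 b0.
have a0' : a != 0 := lt0r_neq0 a0.
have b0' : b != 0 := lt0r_neq0 b0.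
have ab0' : a + b != 0 := lt0r_neq0 ab0.
pose t := a / (a + b).
have t0 : 0 <= t := divr_ge0 (ltW a0) (ltW ab0).
have t1 : t <= 1 by rewrite ler_pdivrMr // mul1r lerDl; exact: ltW.
have tE : 1 - t = b / (a + b) by rewrite /t; field.
suff H : \sum_(i < d) `|(x + y) 0 i| `^ p <= (a + b) `^ p.
  rewrite -[leRHS](powRr1 (ltW ab0)) -(mulfV (lt0r_neq0 p0)) powRrM.
  apply: ge0_ler_powR => //; rewrite ?nnegrE ?powR_ge0 //.
  by rewrite invr_ge0 ltW.
have powRdiv (u c : R) : 0 <= u -> 0 < c -> (u / c) `^ p = u `^ p / c `^ p.
  move=> u0 c0; rewrite powRM ?invr_ge0 ?(ltW c0) //.
  by rewrite -powR_inv1 ?(ltW c0) // powRAC powR_inv1 ?powR_ge0.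
have step (i : 'I_d) : `|(x + y) 0 i| `^ p <= (a + b) `^ p *
    (t * (`|x 0 i| `^ p / a `^ p) + (1 - t) * (`|y 0 i| `^ p / b `^ p)).
  have u0 : 0 <= `|x 0 i| / a := divr_ge0 (normr_ge0 _) (ltW a0).
  have v0 : 0 <= `|y 0 i| / b := divr_ge0 (normr_ge0 _) (ltW b0).
  have w0 : 0 <= t * (`|x 0 i| / a) + (1 - t) * (`|y 0 i| / b).
    by apply: addr_ge0; apply: mulr_ge0 => //; rewrite subr_ge0.
  have := @convex_powR R p p1 (Itv01 t0 t1) (`|x 0 i| / a) (`|y 0 i| / b).
  rewrite !inE /= !in_itv /= !andbT => /(_ u0 v0).
  rewrite !convRE /= !powRdiv // => hc.
  apply: le_trans (ler_wpM2l (powR_ge0 _ _) hc).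
  rewrite -powRM ?(ltW ab0) //.
  have -> : (a + b) * (t * (`|x 0 i| / a) + (1 - t) * (`|y 0 i| / b)) =
            `|x 0 i| + `|y 0 i|.
    by rewrite tE /t; field; rewrite a0' b0' ab0'.
  apply: ge0_ler_powR; rewrite ?nnegrE ?addr_ge0 ?(ltW p0) //.
  by rewrite mxE ler_normD.
apply: le_trans (ler_sum _ (fun i _ => step i)) _.
rewrite -mulr_sumr big_split /= -!mulr_sumr -!mulr_suml -aX -bX.
by rewrite !divff ?lt0r_neq0 ?powR_gt0 // !mulr1 subrKC mulr1.
Qed.

End PNorm.

Definition lp (R : realType) (p : R) (p1 : 1 <= p) (d : nat) : Type := 'rV[R]_d.

HB.instance Definition _ (R : realType) (p : R) (p1 : 1 <= p) (d : nat) :=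
  GRing.Lmodule.copy (lp p1 d) 'rV[R]_d.

HB.instance Definition _ (R : realType) (p : R) (p1 : 1 <= p) (d : nat) :=
  Lmodule_isNormed.Build R (lp p1 d)
    (@pnormD R p d p1) (@pnormZ R p d p1) (@pnorm0_eq0 R p d).

Lemma lp_normE (R : realType) (p : R) (p1 : 1 <= p) (d : nat) (x : lp p1 d) :
  `|x| = (\sum_(i < d) `|(x : 'rV[R]_d) 0 i| `^ p) `^ p^-1.
Proof. by []. Qed.

(* The relation e is the adjacency relation of a simple graph on T. *)
Definition is_tree (T : finType) (e : rel T) : Prop :=
  [/\ symmetric e, irreflexive e, (0 < #|T|)%N,
      forall x y, connect e x y
    & forall c : seq T, (2 < size c)%N -> ~~ ucycleb e c].

Definition degree (T : finType) (e : rel T) (x : T) : nat := #|[pred y | e x y]|.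

Section Steiner.
Variables (R : realType) (X : normedModType R).
Local Open Scope fset_scope.

(* The sum runs over ordered pairs, so it counts every edge {x, y} twice. *)
Definition tree_length (V : {fset X}) (e : rel V) : R :=
  (\sum_(x : V) \sum_(y : V | e x y) `|val x - val y|) / 2.

Definition is_SMT (S V : {fset X}) (e : rel V) : Prop :=
  [/\ S `<=` V, is_tree e
    & forall (V' : {fset X}) (e' : rel V'),
        S `<=` V' -> is_tree e' -> tree_length e <= tree_length e'].

Definition vertex_degree (n : nat) : Prop :=
  exists (S V : {fset X}) (e : rel V) (x : V),
    [/\ is_SMT S e, val x \in S & n = degree e x].

Definition steiner_degree (n : nat) : Prop :=
  exists (S V : {fset X}) (e : rel V) (x : V),
    [/\ is_SMT S e, val x \notin S & n = degree e x].

End Steiner.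

Definition is_largest (A : nat -> Prop) (n : nat) : Prop :=
  A n /\ forall m, A m -> (m <= n)%N.

Definition is_v (R : realType) (X : normedModType R) (n : nat) : Prop :=
  is_largest (@vertex_degree R X) n.

Definition is_s (R : realType) (X : normedModType R) (n : nat) : Prop :=
  is_largest (@steiner_degree R X) n.

(* For n = 2 the base n - 2 vanishes, and 0 `^ q = 0 since q != 0. *)
Definition is_f (R : realType) (q : R) (n : nat) : Prop :=
  is_largest (fun n => (2 <= n)%N /\
    2 * (n%:R - 2) `^ q + (n%:R - 2) * 2 `^ q <= (n%:R - 1) `^ q + n%:R - 1) n.

(* Main.v *)
(* Let x have neighbours y_1, ..., y_n in a Steiner minimal tree.  Joining any
   subset of them to a new point near x instead shows that the norming
   functionals phi_i of a_i = y_i - x have all their subset sums in the dual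
   unit ball, i.e. the unit ball of l_q.  Conversely a star whose functionals
   have this property is minimal: sending the leaves of a competing tree to its
   root, each edge is crossed by a subset of the functionals.

   Upper bounds.  Clarkson's inequality gives signs with
   n <= |sum_i eps_i phi_i|_q^q, and splitting the sum by sign bounds it by 2^q.
   The matrix (phi_j(a_i)) has negative off-diagonal entries and nonnegative row
   sums, hence rank at least n - 1, so n <= d + 1.

   Lower bounds.  The functionals are multiples of n e_i - (1, ..., 1).  Their
   subset sums are controlled by G(x) = x (1 - x)^q + (1 - x) x^q at x = k / n;
   once G starts to decrease on (0, 1/2] it goes on doing so, hence
   G(2/n) <= G(1/n), the condition defining f, is enough for all k, and passes
   to smaller n. *)
Require Import Defs.
From mathcomp Require Import all_boot all_order all_algebra finmap.
From mathcomp Require Import all_classical all_reals all_analysis.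
From mathcomp Require Import ring lra zify.
From Stdlib Require NArith.

Set Implicit Arguments.
Unset Strict Implicit.
Unset Printing Implicit Defensive.

Import Order.TTheory GRing.Theory Num.Theory.
Import numFieldNormedType.Exports.

Local Open Scope ring_scope.

(** * Trees as parent structures *)

Section ParentTree.
Variables (T : finType) (r : T) (par : T -> T) (dep : T -> nat).

(** [dep] only has to drop strictly from a vertex to its parent; it need not be the distance to the
    root, and [par r] is arbitrary. Modified trees can thus be checked with rescaled depths. *)
Definition parent_structure : Prop :=
  dep r = 0%N /\ forall x, x != r -> (dep (par x) < dep x)%N.

Definition parent_rel : rel T :=
  [rel x y | (x != r) && (par x == y) || (y != r) && (par y == x)].

Hypothesis hpar : parent_structure.

Lemma dep_eq0 x : dep x = 0%N -> x = r.
Proof.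
by move=> d0; apply/eqP; apply: contraT => /(proj2 hpar); rewrite d0.
Qed.

Lemma parent_rel_sym : symmetric parent_rel.
Proof. by move=> x y; rewrite /parent_rel /= orbC. Qed.

Lemma parent_rel_irr : irreflexive parent_rel.
Proof.
move=> x; rewrite /parent_rel /= orbb; apply/negP => /andP[/(proj2 hpar) + /eqP e].
by rewrite e ltnn.
Qed.

Lemma parent_rel_tree : is_tree parent_rel.
Proof.
have conn x : connect parent_rel x r.
  have [n] := ubnP (dep x); elim: n x => // n IH x dx.
  have [->|xr] := eqVneq x r; first exact: connect0.
  have lt := proj2 hpar x xr.
  apply: connect_trans (IH (par x) _); last exact: leq_trans lt _.
  by apply: connect1; rewrite /parent_rel /= xr eqxx.
split.
- exact: parent_rel_sym.
- exact: parent_rel_irr.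
- by apply/card_gt0P; exists r.
- move=> x y; apply: connect_trans (conn x) _.
  by rewrite (sym_connect_sym parent_rel_sym).
move=> c sz; apply/negP => uc.
(* Both neighbours on the cycle of a vertex of maximal depth are its parent. *)
have [x0 x0c] : exists x0, x0 \in c by case: c sz {uc} => // x0 ? _; exists x0; rewrite inE eqxx.
have [x xc xmax] := @arg_maxnP T x0 (mem c) dep x0c.
have onlypar y : y \in c -> parent_rel x y -> y = par x.
  move=> yc /orP[/andP[_ /eqP->]//|/andP[yr /eqP ex]].
  by have := proj2 hpar y yr; rewrite ex ltnNge => /negP[]; exact: xmax.
have [i s cE] := rot_to xc.
move: uc; rewrite /ucycleb -(rot_cycle i) -(rot_uniq i) cE.
have sub y : y \in x :: s -> y \in c by rewrite -cE mem_rot.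
have : size (x :: s) = size c by rewrite -cE size_rot.
case: s sub {cE} => [|y [|z s]] sub /=; try by move=> E; move: sz; rewrite -E.
move=> _ /andP[/andP[exy]]; rewrite rcons_path /= => /and3P[_ _ elx].
move=> /and3P[_ + _]; rewrite inE negb_or => /andP[yz ys].
have yE : y = par x by apply: onlypar exy; apply: sub; rewrite !inE eqxx orbT.
suff lE : last z s = par x.
  by have := mem_last z s; rewrite inE lE -yE (negPf ys) orbF (negPf yz).
apply: onlypar; last by rewrite parent_rel_sym.
by apply: sub; rewrite 2!inE mem_last !orbT.
Qed.

Section Length.
Variables (R : realType) (X : normedModType R) (f : T -> X).

Definition parent_length : R := \sum_(x | x != r) `|f x - f (par x)|.

Lemma sum_parent_rel :
  (\sum_x \sum_(y | parent_rel x y) `|f x - f y|) / 2 = parent_length.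
Proof.
pose P x y := (x != r) && (par x == y).
have E x : \sum_(y | parent_rel x y) `|f x - f y| =
    \sum_(y | P x y) `|f x - f y| + \sum_(y | P y x) `|f x - f y|.
  (* Every edge is oriented from child to parent in exactly one way: two vertices that were parents
     of each other would have to lie strictly below each other. *)
  rewrite (bigID (P x)) /=; congr (_ + _); apply: eq_bigl => y;
    rewrite /parent_rel /P /=; first by apply: andb_idl => ->.
  case: (boolP ((x != r) && (par x == y))) => //= [|_]; last by rewrite andbT.
  case/andP => xr /eqP <-; apply/esym/negP => /andP[pr /eqP ppx].
  have := ltn_trans (proj2 hpar _ pr) (proj2 hpar _ xr).
  by rewrite ppx ltnn.
have S : \sum_x \sum_(y | P x y) `|f x - f y| = parent_length.
  rewrite /parent_length [RHS]big_mkcond; apply: eq_bigr => x _ /=; rewrite /P.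
  case: ifP => _ /=; last by rewrite big_pred0.
  by rewrite (big_pred1 (par x)) // => y; rewrite /= eq_sym.
under eq_bigr => x _ do rewrite E.
rewrite big_split /= S (exchange_big_dep predT) //=.
under [X in _ + X]eq_bigr => x _ do under eq_bigr => y _ do rewrite distrC.
by rewrite S; field.
Qed.

Lemma parent_length_le (e : rel T) :
    symmetric e -> (forall x, x != r -> e x (par x)) ->
  parent_length <= (\sum_x \sum_(y | e x y) `|f x - f y|) / 2.
Proof.
move=> esym epar; rewrite -sum_parent_rel ler_pM2r ?invr_gt0 //.
apply: ler_sum => x _; rewrite [leLHS]big_mkcond [leRHS]big_mkcond /=.
apply: ler_sum => y _; case: ifP => [|_]; last by case: ifP.
case/orP => /andP[xr /eqP <-]; first by rewrite epar.
by rewrite esym epar.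
Qed.

(* Push the points [b i] towards the root one level at a time: each edge from
   [x] to [par x] is then crossed by the functionals of a subset of indices. *)
Lemma calibration (I : finType) (phi : I -> X -> R) (b : I -> T) :
    (forall i u v, phi i (u - v) = phi i u - phi i v) ->
    (forall (A : {set I}) w, \sum_(i in A) phi i w <= `|w|) ->
  \sum_i phi i (f (b i) - f r) <= parent_length.
Proof.
move=> phiB phile.
suff H N : forall b : I -> T, (forall i, (dep (b i) <= N)%N) ->
    \sum_i phi i (f (b i) - f r) <=
    \sum_(x | (x != r) && (dep x <= N)%N) `|f x - f (par x)|.
  apply: le_trans (H (\max_i dep (b i)) b (fun i => leq_bigmax i)) _.
  rewrite /parent_length [leRHS](bigID (fun x => dep x <= \max_i dep (b i))%N) /=.
  by rewrite lerDl sumr_ge0.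
elim: N => [|N IH] {}b hb.
  rewrite big1 ?sumr_ge0 // => i _.
  have /dep_eq0 -> : dep (b i) = 0%N by apply/eqP; rewrite -leqn0.
  by rewrite phiB subrr.
pose b' i := if dep (b i) == N.+1 then par (b i) else b i.
have nr x n : dep x = n.+1 -> x != r.
  by move=> dx; apply/eqP => xr; move: dx; rewrite xr (proj1 hpar).
have hb' i : (dep (b' i) <= N)%N.
  rewrite /b'; case: eqP => [db|/eqP db].
    by have := proj2 hpar _ (nr _ _ db); rewrite db ltnS.
  by have := hb i; rewrite leq_eqVlt (negPf db).
have -> : \sum_i phi i (f (b i) - f r) =
    \sum_i phi i (f (b' i) - f r) + \sum_i phi i (f (b i) - f (b' i)).
  by rewrite -big_split; apply: eq_bigr => i _ /=; rewrite !phiB; ring.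
rewrite [leRHS](bigID (fun x => dep x <= N)%N) /=.
apply: lerD.
  apply: le_trans (IH _ hb') _; rewrite le_eqVlt; apply/orP; left; apply/eqP.
  apply: eq_bigl => x; rewrite -andbA; congr (_ && _).
  by case: (leqP (dep x) N) => h; rewrite ?andbF // (leqW h).
(* Indices are grouped by the point they occupy; the group at a deepest point [x] crosses the single
   edge from [x] to [par x]. *)
rewrite (partition_big b predT) //= (bigID (fun x => dep x == N.+1)) /=.
rewrite [X in _ + X]big1 ?addr0 => [|x dx]; last first.
  by rewrite big1 // => i /eqP bi; rewrite /b' bi (negPf dx) phiB subrr.
rewrite [leRHS](eq_bigl (fun x => dep x == N.+1)) => [|x]; last first.
  rewrite -ltnNge -andbA -eqn_leq.
  by case: (eqVneq (dep x)) => [/nr ->|]; rewrite ?andbF.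
apply: ler_sum => x /eqP dx.
have -> : \sum_(i | b i == x) phi i (f (b i) - f (b' i)) =
    \sum_(i in [set i | b i == x]) phi i (f x - f (par x)).
  apply: eq_big => [i|i /eqP bi]; first by rewrite inE.
  by rewrite /b' bi dx eqxx.
exact: phile.
Qed.
End Length.
End ParentTree.

(** The depth is the length of a shortest path from [r], the parent the last vertex but one on such
    a path. The final clause makes all neighbours of [r] its children, as the exchange argument
    requires. *)
Lemma bfs_parent (T : finType) (e : rel T) (r : T) :
    symmetric e -> (forall y, connect e r y) ->
  exists (par : T -> T) (dep : T -> nat), [/\ dep r = 0%N,
    forall x, x != r -> dep x = (dep (par x)).+1,
    forall x, x != r -> e x (par x)
  & forall y, y != r -> e r y -> dep y = 1%N].
Proof.
move=> esym conn.
(* Tuples of fixed length form a finite type, so [P] is boolean and [ex_minn] applies. *)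
pose P x n := [exists t : n.-tuple T, path e r t && (last r t == x)].
have PP x n : reflect (exists2 s, path e r s /\ last r s = x & size s = n) (P x n).
  apply: (iffP existsP) => [[t /andP[pt /eqP lt]]|[s [ps ls] <-]].
    by exists t => //; rewrite size_tuple.
  by exists (in_tuple s); rewrite /= ps ls eqxx.
have exP x : exists n, P x n.
  by have /connectP[s ps ls] := conn x; exists (size s); apply/PP; exists s.
pose dep x := ex_minn (exP x).
have depP x : P x (dep x) by rewrite /dep; case: ex_minnP.
have depmin x n : P x n -> (dep x <= n)%N by rewrite /dep; case: ex_minnP => m _; apply.
have step x y n : P y n -> e y x -> P x n.+1.
  move=> /PP[s [ps ls] ss] eyx; apply/PP; exists (rcons s x); rewrite ?size_rcons ?ss //.
  by rewrite rcons_path ps ls last_rcons.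
have dep0 x : dep x = 0%N -> x = r.
  by move=> d0; have := depP x; rewrite d0 => /PP[[|//] [_ <-]].
have depr : dep r = 0%N.
  by apply/eqP; rewrite -leqn0; apply: depmin; apply/PP; exists [::].
have exy x : exists y, x != r -> e x y /\ dep x = (dep y).+1.
  have [->|xr] := eqVneq x r; first by exists r.
  have /PP[s] := depP x; case: (lastP s) => [|s' z].
    by move=> [_ /= rx]; rewrite -rx eqxx in xr.
  rewrite rcons_path last_rcons size_rcons => -[/andP[ps' ez] zx] sz.
  rewrite {z}zx in ez.
  exists (last r s') => _; rewrite esym; split=> //.
  apply/eqP; rewrite eqn_leq (depmin _ _ (step _ _ _ (depP (last r s')) ez)) /=.
  by rewrite -sz ltnS; apply: depmin; apply/PP; exists s'.
have [par parP] := choice exy.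
exists par, dep; split=> //.
- by move=> x /parP[].
- by move=> x /parP[].
- move=> y yr ery; apply/eqP; rewrite eqn_leq lt0n; apply/andP; split.
    by apply: depmin; apply: (step _ r) => //; apply/PP; exists [::].
  by apply: contra yr => /eqP/dep0 ->.
Qed.

(** * Exchange and calibration for Steiner minimal trees *)

Section SteinerTrees.
Variables (R : realType) (X : normedModType R).

(* The image in [X] of a tree is spanned by a tree: send each image point to
   the image of the parent of its preimage of least depth. *)
Lemma SMT_le_parent_length (S V : {fset X}) (e : rel V) (T : finType) (r : T)
    (par : T -> T) (dep : T -> nat) (f : T -> X) :
    is_SMT S e -> parent_structure r par dep ->
    (forall s, s \in S -> exists t, f t = s) ->
  tree_length e <= parent_length r par f.
Proof.
move=> [_ _ smin] hpar cover.
pose V' := [fset f t | t in T]%fset.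
have fV t : f t \in V' by apply/imfsetP; exists t.
pose g t : V' := FSetSub (fV t).
have gsurj v : exists t, g t = v.
  by have /imfsetP[t _ tv] := valP v; exists t; apply/val_inj.
have exrho v : exists t, g t = v /\ forall t', g t' = v -> (dep t <= dep t')%N.
  have [t0 gt0] := gsurj v.
  have gt0' : g t0 == v by apply/eqP.
  case: (@arg_minnP T t0 (fun t => g t == v) dep gt0') => t /eqP gt tmin.
  by exists t; split=> // t' /eqP; exact: tmin.
have [rho rhoP] := choice exrho.
have rhoK : cancel rho g by move=> v; have [] := rhoP v.
have hpar' : parent_structure (g r) (g \o par \o rho) (dep \o rho).
  split=> /= [|v vr].
    apply/eqP; rewrite -leqn0 -(proj1 hpar); exact: (proj2 (rhoP (g r))).
  apply: leq_ltn_trans (proj2 hpar (rho v) _); first exact: (proj2 (rhoP _)).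
  by apply: contra_neq vr => <-; rewrite rhoK.
have SV' : (S `<=` V')%fset by apply/fsubsetP => s /cover[t <-].
apply: le_trans (smin V' _ SV' (parent_rel_tree hpar')) _.
rewrite /tree_length (sum_parent_rel hpar' (fun v => val v)) /parent_length /=.
have rinj : injective rho := can_inj rhoK.
have -> : \sum_(v | v != g r) `|val v - f (par (rho v))| =
    \sum_(x in rho @: [set v | v != g r]) `|f x - f (par x)|.
  rewrite big_imset /=; last by move=> u v _ _; exact: rinj.
  apply: eq_big => [v|v _]; first by rewrite inE.
  by rewrite -{1}(rhoK v).
rewrite /parent_length big_mkcond [leRHS]big_mkcond /=.
apply: ler_sum => x _; case: imsetP => [[v]|_]; last by case: ifP.
rewrite inE => vr ->; case: eqP => // rv.
by move: vr; rewrite -rv rhoK eqxx.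
Qed.

(* Re-attach the neighbours in [A] of [x] to a new point [z] joined to [x]. *)
Lemma SMT_exchange (S V : {fset X}) (e : rel V) (x : V) (A : {set V}) (z : X) :
    is_SMT S e -> (forall y, y \in A -> e x y) ->
  0 <= \sum_(y in A) (`|val y - z| - `|val y - val x|) + `|z - val x|.
Proof.
move=> smt Ax; have [SV [esym eirr _ conn _] _] := smt.
have [par [dep [dr dpar epar dn]]] := bfs_parent esym (conn x).
have nx y : y \in A -> y != x.
  by move=> /Ax; apply: contraTneq => ->; rewrite eirr.
have parA y : y \in A -> par y = x.
  move=> yA; have := dpar y (nx y yA); rewrite (dn _ (nx y yA) (Ax y yA)) => -[d0].
  by apply/eqP; apply: contraT => /dpar; rewrite -d0.
(* [None] is the new point [z]. It may coincide in [X] with an old vertex, because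
   [SMT_le_parent_length] accepts any map [f], injective or not. *)
pose par' (o : option V) := if o is Some y then
  if y \in A then None else Some (par y) else Some x.
(* Doubling makes room at depth 1 for [z], between [x] at 0 and the points of [A] at 2. *)
pose dep' (o : option V) := if o is Some y then (dep y).*2 else 1%N.
pose f (o : option V) := if o is Some y then val y else z.
have hpar' : parent_structure (Some x) par' dep'.
  split=> [|[y yx|_]]; rewrite /= ?dr //.
  have yx' : y != x by apply: contra_neq yx => ->.
  by rewrite dpar //; case: ifP => _ /=; lia.
have cover s : s \in S -> exists t, f t = s.
  by move=> sS; exists (Some (FSetSub (fsubsetP SV s sS))).
have hpar0 : parent_structure x par dep by split=> // y /dpar ->.
have := SMT_le_parent_length smt hpar' cover.
move=> hle; have := le_trans (parent_length_le (r := x) hpar0 (fun v => val v) esym epar) hle.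
rewrite [X in _ <= X -> _]/parent_length (bigD1 None) //= (reindex_omap Some id) => [|[]//].
rewrite /parent_length [X in X <= _ -> _](bigID (mem A)) /=.
rewrite [X in _ <= _ + X -> _](eq_bigl (fun y => y != x)) => [|y]; last by rewrite eqxx !andbT.
rewrite [X in _ <= _ + X -> _](bigID (mem A)) /=.
have selA (F : V -> R) : \sum_(y | (y != x) && (y \in A)) F y = \sum_(y in A) F y.
  by apply: eq_bigl => y; case: (boolP (y \in A)) => [/nx ->//|]; rewrite andbF.
rewrite !selA.
have -> : \sum_(y in A) `|fsval y - fsval (par y)| = \sum_(y in A) `|fsval y - fsval x|.
  by apply: eq_bigr => y /parA ->.
have -> : \sum_(y in A) `|fsval y - f (if y \in A then None else Some (par y))| =
    \sum_(y in A) `|fsval y - z| by apply: eq_bigr => y ->.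
have -> : \sum_(y | (y != x) && (y \notin A))
     `|fsval y - f (if y \in A then None else Some (par y))| =
   \sum_(y | (y != x) && (y \notin A)) `|fsval y - fsval (par y)|.
  by apply: eq_bigr => y /andP[_ /negPf ->].
by rewrite sumrB /=; lra.
Qed.

Lemma tree_calibration (V : {fset X}) (e : rel V) (r : V) (I : finType)
    (phi : I -> X -> R) (b : I -> V) : is_tree e ->
    (forall i u v, phi i (u - v) = phi i u - phi i v) ->
    (forall (A : {set I}) w, \sum_(i in A) phi i w <= `|w|) ->
  \sum_i phi i (val (b i) - val r) <= tree_length e.
Proof.
move=> [esym _ _ conn _] phiB phile.
have [par [dep [dr dpar epar _]]] := bfs_parent esym (conn r).
have hpar : parent_structure r par dep by split=> // y /dpar ->.
apply: le_trans (calibration hpar (fun v : V => val v) b phiB phile) _.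
exact: (parent_length_le hpar (fun v : V => val v) esym epar).
Qed.

(** * Minimal stars around the origin *)

Section Star.
Variables (n : nat) (a : 'I_n -> X) (phi : 'I_n -> X -> R).
Hypothesis phiB : forall i u v, phi i (u - v) = phi i u - phi i v.
Hypothesis phile : forall (A : {set 'I_n}) w, \sum_(i in A) phi i w <= `|w|.
Hypothesis a1 : forall i, `|a i| = 1.
Hypothesis phia : forall i, phi i (a i) = 1.

(** If two leaves coincided, the sum of their two functionals would take the value 2 on a unit
    vector. *)
Let a_inj : injective a.
Proof.
move=> i j aij; apply/eqP; apply: contraT => ij.
have := phile [set i; j] (a i).
rewrite big_setU1 ?inE //= big_set1 phia {1}aij phia a1; lra.
Qed.

Let L := [fset a i | i in 'I_n]%fset.
Let V := (0 |` L)%fset.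

Let L0 : 0 \notin L.
Proof.
by apply/imfsetP => -[i _] ai; have /eqP := a1 i; rewrite -ai normr0 eq_sym oner_eq0.
Qed.

Let V0 : 0 \in V. Proof. by rewrite !inE eqxx. Qed.

Let r : V := FSetSub V0.
Let par (v : V) := r.
Let e := parent_rel r par.

Let hpar : parent_structure r par (fun v => v != r : nat).
Proof. by split=> [|x ->]; rewrite ?eqxx. Qed.

Let card_nr : #|[pred v | v != r]| = n.
Proof.
have cV : #|` V| = n.+1.
  by rewrite cardfsU1 L0 (card_imfset _ _ a_inj) /= -cardE card_ord.
by have := cardC1 r; rewrite -cardfE cV.
Qed.

Let length_e : tree_length e = n%:R.
Proof.
rewrite /tree_length (sum_parent_rel hpar (fun v : V => val v)) /parent_length.
rewrite (eq_bigr (fun=> 1)) => [|v vr].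
  by rewrite sumr_const -card_nr.
rewrite /= subr0; have := valP v; rewrite !inE => /orP[/eqP v0|/imfsetP[i _ ->//]].
by move: vr; rewrite -val_eqE /= v0 eqxx.
Qed.

Let degree_e : degree e r = n.
Proof.
rewrite -card_nr; apply: eq_card => v; rewrite !inE /e /parent_rel /= eqxx /=.
by rewrite andbT.
Qed.

(** Calibrating the competitor from the root [c] gives the lower bound n - sum_i phi_i(c), which is
    the length n of the star once the sum vanishes at [c]. *)
Let minimal (V' : {fset X}) (e' : rel V') (c : V') : (L `<=` V')%fset ->
  is_tree e' -> \sum_i phi i (val c) = 0 -> tree_length e <= tree_length e'.
Proof.
move=> LV' te' c0.
have aV' i : a i \in V' by apply: (fsubsetP LV'); apply/imfsetP; exists i.
have := tree_calibration c (fun i => FSetSub (aV' i)) te' phiB phile.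
apply: le_trans; rewrite length_e /=.
under eq_bigr => i _ do rewrite phiB phia.
by rewrite sumrB c0 subr0 sumr_const card_ord.
Qed.

(** Here the origin is one of the given points, so every competitor contains it and can be rooted
    there. *)
Lemma star_vertex_degree : vertex_degree X n.
Proof.
exists V, V, e, r; split; [split=> // | exact: V0 | exact/esym/degree_e].
  exact: parent_rel_tree hpar.
move=> V' e' VV' te'.
have c0 : 0 \in V' by apply: (fsubsetP VV').
apply: (minimal (c := FSetSub c0)) te' _.
  by apply: fsubset_trans VV'; exact: fsubsetU1.
by apply: big1 => i _; have := phiB i 0 0; rewrite !subrr.
Qed.

(** Only the leaves are given now, and a competitor may avoid the origin. Since the functionals sum
    to zero everywhere, it can be rooted at any leaf instead. *)
Lemma star_steiner_degree : (0 < n)%N -> (forall w, \sum_i phi i w = 0) ->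
  steiner_degree X n.
Proof.
move=> n0 sum0.
exists L, V, e, r; split; [split; first exact: fsubsetU1 | exact: L0 | exact/esym/degree_e].
  exact: parent_rel_tree hpar.
move=> V' e' LV' te'.
have c0 : a (Ordinal n0) \in V' by apply: (fsubsetP LV'); apply/imfsetP; exists (Ordinal n0).
exact: (minimal (c := FSetSub c0)).
Qed.
End Star.
End SteinerTrees.

(** * Powers and the finite-dimensional l_p norm *)

Section ScalarPowers.
Variable R : realType.
Implicit Types (a b x y r p q : R).

Lemma powR_div x y r : 0 <= x -> 0 < y -> (x / y) `^ r = x `^ r / y `^ r.
Proof.
move=> x0 y0; rewrite powRM ?invr_ge0 ?(ltW y0) //.
by rewrite -powR_inv1 ?(ltW y0) // powRAC powR_inv1 ?powR_ge0.
Qed.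

(** The signed power: [p * spow (p - 1) x] is the derivative of |x|^p. *)
Definition spow r x : R := Num.sg x * `|x| `^ r.

Lemma spowM r x : 0 < r -> spow (r - 1) x * x = `|x| `^ r.
Proof.
move=> r0; rewrite /spow mulrAC -normrEsg; exact: mulr_powRB1.
Qed.

Lemma norm_spow r x : r != 0 -> `|spow r x| = `|x| `^ r.
Proof.
move=> r0; rewrite /spow normrM normr_sg (ger0_norm (powR_ge0 _ _)).
by have [->|x0] := eqVneq x 0; rewrite ?normr0 ?powR0 ?mulr0 // mul1r.
Qed.

Lemma young x y p q : 0 < p -> 0 < q -> p^-1 + q^-1 = 1 ->
  x * y <= `|x| `^ p / p + `|y| `^ q / q.
Proof.
move=> p0 q0 pq; apply: le_trans (conjugate_powR _ _ p0 q0 pq) => //.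
by rewrite -normrM ler_norm.
Qed.

(** Convexity of |x|^p, obtained without derivatives from Young's inequality for [x] and
    [spow (p - 1) y]. *)
Lemma powR_tangent p x y : 1 < p ->
  `|y| `^ p + p * spow (p - 1) y * (x - y) <= `|x| `^ p.
Proof.
move=> p1; have p0 : 0 < p by lra.
have p10 : p - 1 != 0 by lra.
pose q := p / (p - 1).
have q0 : 0 < q by rewrite divr_gt0 //; lra.
have pq : p^-1 + q^-1 = 1 by rewrite /q; field; rewrite p10 gt_eqF.
have := @young x (spow (p - 1) y) p q p0 q0 pq.
rewrite norm_spow // -powRrM (_ : (p - 1) * q = p); last by rewrite /q; field.
rewrite -(ler_pM2l p0) mulrDr.
have -> : p * (`|x| `^ p / p) = `|x| `^ p by field; rewrite gt_eqF.
have -> : p * (`|y| `^ p / q) = (p - 1) * `|y| `^ p.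
  by rewrite /q; field; rewrite p10 gt_eqF.
have := spowM y p0; set s := spow _ _; set Y := `|y| `^ p; set X := `|x| `^ p.
by move=> <-; lra.
Qed.

(** After division by a + b both terms lie in (0, 1], where t <= t^r. The superadditive companion
    uses t^r <= t. *)
Lemma powR_subadd a b r : 0 <= a -> 0 <= b -> 0 < r -> r <= 1 ->
  (a + b) `^ r <= a `^ r + b `^ r.
Proof.
move=> a0 b0 r0 r1.
have [->|na] := eqVneq a 0; first by rewrite add0r powR0 ?gt_eqF // add0r.
have [->|nb] := eqVneq b 0; first by rewrite addr0 powR0 ?gt_eqF // addr0.
have {na}a0 : 0 < a by rewrite lt_def na.
have {nb}b0 : 0 < b by rewrite lt_def nb.
have ab0 : 0 < a + b by rewrite addr_gt0.
have H c : 0 < c -> c <= a + b -> c / (a + b) <= c `^ r / (a + b) `^ r.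
  move=> c0 cab; rewrite -powR_div ?(ltW c0) //; apply: ger1_powR => //.
  by rewrite divr_gt0 //= ler_pdivrMr // mul1r.
have := lerD (H a a0 _) (H b b0 _); rewrite lerDl lerDr !(ltW a0, ltW b0).
move=> /(_ isT isT); rewrite -!mulrDl divff ?gt_eqF //.
by rewrite ler_pdivlMr ?powR_gt0 // mul1r.
Qed.

Lemma powR_superadd a b r : 0 <= a -> 0 <= b -> 1 <= r ->
  a `^ r + b `^ r <= (a + b) `^ r.
Proof.
move=> a0 b0 r1; have r0 : 0 < r by lra.
have [->|na] := eqVneq a 0; first by rewrite add0r powR0 ?gt_eqF // add0r.
have [->|nb] := eqVneq b 0; first by rewrite addr0 powR0 ?gt_eqF // addr0.
have {na}a0 : 0 < a by rewrite lt_def na.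
have {nb}b0 : 0 < b by rewrite lt_def nb.
have ab0 : 0 < a + b by rewrite addr_gt0.
have H c : 0 < c -> c <= a + b -> c `^ r / (a + b) `^ r <= c / (a + b).
  move=> c0 cab; rewrite -powR_div ?(ltW c0) //; apply: ge1r_powR => //.
  by rewrite divr_gt0 //= ler_pdivrMr // mul1r.
have := lerD (H a a0 _) (H b b0 _); rewrite lerDl lerDr !(ltW a0, ltW b0).
move=> /(_ isT isT); rewrite -!mulrDl divff ?gt_eqF //.
by rewrite ler_pdivrMr ?powR_gt0 // mul1r.
Qed.

(** For equal signs this is subadditivity; for opposite signs |x| and |y| are both at most |x - y|,
    whence the factor 2. *)
Lemma spow_holder r x y : 0 < r -> r <= 1 ->
  `|spow r x - spow r y| <= 2 * `|x - y| `^ r.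
Proof.
move=> r0 r1.
have same a b : 0 <= b -> b <= a -> `|a `^ r - b `^ r| <= 2 * `|a - b| `^ r.
  move=> b0 ab; have ab0 : 0 <= a - b by rewrite subr_ge0.
  have := powR_subadd b0 ab0 r0 r1; rewrite subrKC => H.
  rewrite !ger0_norm ?subr_ge0 ?ge0_ler_powR ?nnegrE ?(ltW r0) ?(le_trans b0) //.
  by have := powR_ge0 (a - b) r; lra.
have pos a : 0 <= a -> spow r a = a `^ r.
  rewrite le_eqVlt => /orP[/eqP <-|a0].
    by rewrite /spow sgr0 mul0r powR0 // gt_eqF.
  by rewrite /spow gtr0_sg // mul1r gtr0_norm.
have neg a : spow r (- a) = - spow r a by rewrite /spow sgrN normrN mulNr.
have main a b : b <= a -> 0 <= a -> `|spow r a - spow r b| <= 2 * `|a - b| `^ r.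
  move=> ab a0; have [b0|b0] := leP 0 b; first by rewrite !pos // same.
  have nb0 : 0 <= - b by lra.
  have -> : spow r b = - (- b) `^ r by rewrite -pos // neg opprK.
  rewrite pos // opprK.
  have H c : 0 <= c -> c <= a - b -> c `^ r <= (a - b) `^ r.
    by move=> c0 cab; apply: ge0_ler_powR; rewrite ?nnegrE ?(ltW r0) // (le_trans c0).
  rewrite ger0_norm ?addr_ge0 ?powR_ge0 // ger0_norm; last by lra.
  by have := H a a0; have := H _ nb0; lra.
have main2 a b : 0 <= a -> `|spow r a - spow r b| <= 2 * `|a - b| `^ r.
  move=> a0; have [ab|/ltW ab] := leP b a; first exact: main.
  by rewrite distrC (distrC a) main // (le_trans a0).
have [x0|x0] := leP 0 x; first exact: main2.
have nx0 : 0 <= - x by lra.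
rewrite -normrN opprD opprK -neg -{2}[y]opprK neg -[in leRHS]normrN opprD opprK addrC.
by have := main2 (- x) (- y) nx0; rewrite !neg !opprK addrC [- x + y]addrC [- _ + spow r y]addrC => ->.
Qed.

(** The tangent inequality based at x + s bounds |x + s|^p from above with slope taken at x + s;
    Hölder continuity moves the slope to x at a cost of order |s|^p. *)
Lemma powR_smooth p x s : 1 < p -> p <= 2 ->
  `|x + s| `^ p <= `|x| `^ p + p * spow (p - 1) x * s + 2 * p * `|s| `^ p.
Proof.
move=> p1 p2; have p0 : 0 < p by lra.
have := @powR_tangent p x (x + s) p1; rewrite opprD addNKr.
have h : 0 < p - 1 by lra.
have h2 : p - 1 <= 1 by lra.
have := spow_holder (x + s) x h h2; rewrite [x + s]addrC addrK [s + x]addrC.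
move=> H1 H2.
have H3 : (spow (p - 1) (x + s) - spow (p - 1) x) * s <= 2 * `|s| `^ p.
  have -> : `|s| `^ p = `|s| * `|s| `^ (p - 1) by rewrite mulr_powRB1.
  apply: le_trans (ler_norm _) _; rewrite normrM.
  by have := ler_wpM2r (normr_ge0 s) H1; lra.
have := ler_wpM2l (ltW p0) H3.
by lra.
Qed.

(** With r = q / 2, take the tangent to t^r at x^2 + y^2. The points (x + y)^2 and (x - y)^2 deviate
    from it by 2xy and -2xy, so the linear terms cancel, and superadditivity finishes. *)
Lemma powR_clarkson q x y : 2 < q ->
  2 * (`|x| `^ q + `|y| `^ q) <= `|x + y| `^ q + `|x - y| `^ q.
Proof.
move=> q2; pose r := q / 2; have r1 : 1 < r by rewrite /r; lra.
have E z : `|z| `^ q = (z ^+ 2) `^ r.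
  by rewrite -real_normK ?num_real // -powR_mulrn // -powRrM /r mulrC divfK.
rewrite !E.
have T := @powR_tangent r _ (x ^+ 2 + y ^+ 2) r1.
have := T ((x + y) ^+ 2); have := T ((x - y) ^+ 2).
rewrite !ger0_norm ?addr_ge0 ?sqr_ge0 //.
have := powR_superadd (sqr_ge0 x) (sqr_ge0 y) (ltW r1).
set S := spow _ _.
have -> : (x - y) ^+ 2 - (x ^+ 2 + y ^+ 2) = - (2 * x * y) by ring.
have -> : (x + y) ^+ 2 - (x ^+ 2 + y ^+ 2) = 2 * x * y by ring.
by rewrite mulrN; lra.
Qed.

Lemma powR_midpoint q x y : 1 < q ->
  `|x - y| `^ q <= 2 `^ (q - 1) * (`|x| `^ q + `|y| `^ q).
Proof.
move=> q1; pose m := (x - y) / 2.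
have := @powR_tangent q x m q1; have := @powR_tangent q (- y) m q1.
rewrite normrN.
have -> : x - m = - (- y - m) by rewrite /m; field.
have -> : `|m| `^ q = `|x - y| `^ q / 2 `^ q.
  by rewrite -powR_div // /m normrM normfV (@ger0_norm _ 2).
have -> : 2 `^ q = 2 * 2 `^ (q - 1) :> R by rewrite mulr_powRB1 //; lra.
have P0 : 0 < 2 `^ (q - 1) :> R by rewrite powR_gt0.
rewrite mulrN => H1 H2.
rewrite mulrC -ler_pdivrMr //.
have -> : `|x - y| `^ q / 2 `^ (q - 1) = 2 * (`|x - y| `^ q / (2 * 2 `^ (q - 1))).
  by field; rewrite gt_eqF.
by lra.
Qed.

Lemma ler_powR_addeps (x y c r : R) : 0 < r -> 0 <= c ->
  (forall t : R, 0 < t -> x <= y + c * t `^ r) -> x <= y.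
Proof.
move=> r0 c0 H; rewrite leNgt; apply/negP => yx.
(* At t = d^(1/r) the error c t^r = c d is smaller than (c + 1) d = x - y. *)
pose d := (x - y) / (c + 1); have d0 : 0 < d by rewrite divr_gt0 //; lra.
have := H (d `^ r^-1) (powR_gt0 _ d0).
rewrite -powRrM mulVf ?gt_eqF // powRr1 ?(ltW d0) //.
have : d * (c + 1) = x - y by rewrite /d divfK //; lra.
by lra.
Qed.
End ScalarPowers.

(** * Duality between l_p and l_q, and smoothness of the l_p norm *)

Section FiniteLp.
Variables (R : realType) (p q : R).
Hypothesis p1 : 1 < p.
Hypothesis p2 : p < 2.
Hypothesis qE : q * (p - 1) = p.

Let p0 : 0 < p. Proof. exact: lt_trans ltr01 p1. Qed.
Let p10 : 0 < p - 1. Proof. by rewrite subr_gt0. Qed.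
Let pn0 : p != 0. Proof. by rewrite gt_eqF. Qed.
Let p1n0 : p - 1 != 0. Proof. by rewrite gt_eqF. Qed.
Let q2 : 2 < q. Proof. by rewrite -(ltr_pM2r p10) qE; move: p2; lra. Qed.
Let q0 : 0 < q. Proof. exact: lt_trans q2. Qed.
Let qn0 : q != 0. Proof. by rewrite gt_eqF. Qed.
Let pq1 : p^-1 + q^-1 = 1.
Proof.
have -> : q = p / (p - 1) by apply: (canRL (mulfK p1n0)).
by field; rewrite p1n0 pn0.
Qed.
Let qq : (q - 1) * p = q. Proof. by move: qE; lra. Qed.

Definition dot d (u v : 'rV[R]_d) : R := \sum_i u 0 i * v 0 i.
(** The r-th power of the l_r norm; without the root, scalar inequalities can be summed over
    coordinates. *)
Definition psum (r : R) d (u : 'rV[R]_d) : R := \sum_i `|u 0 i| `^ r.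

Lemma psum_ge0 r d (u : 'rV[R]_d) : 0 <= psum r u.
Proof. by apply: sumr_ge0 => i _; exact: powR_ge0. Qed.

Lemma psumZ r d c (u : 'rV[R]_d) : psum r (c *: u) = `|c| `^ r * psum r u.
Proof. by rewrite mulr_sumr; apply: eq_bigr => i _; rewrite mxE normrM powRM. Qed.

Lemma pnorm_psum d (u : 'rV[R]_d) : pnorm p u `^ p = psum p u.
Proof. by rewrite /pnorm -powRrM mulVf // powRr1 ?psum_ge0. Qed.

Lemma pnorm_ge0 d (u : 'rV[R]_d) : 0 <= pnorm p u.
Proof. exact: powR_ge0. Qed.

Lemma dot_suml d (I : finType) (P : pred I) (u : I -> 'rV[R]_d) w :
  \sum_(i | P i) dot (u i) w = dot (\sum_(i | P i) u i) w.
Proof. by rewrite exchange_big; apply: eq_bigr => j _; rewrite summxE mulr_suml. Qed.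

Lemma dotBr d (u v w : 'rV[R]_d) : dot u (v - w) = dot u v - dot u w.
Proof. by rewrite -sumrB; apply: eq_bigr => i _; rewrite !mxE mulrBr. Qed.

Lemma dot0l d (w : 'rV[R]_d) : dot 0 w = 0.
Proof. by apply: big1 => i _; rewrite mxE mul0r. Qed.

Lemma dotDl d (u v w : 'rV[R]_d) : dot (u + v) w = dot u w + dot v w.
Proof. by rewrite -big_split; apply: eq_bigr => i _; rewrite !mxE mulrDl. Qed.

Lemma dotZl d c (u w : 'rV[R]_d) : dot (c *: u) w = c * dot u w.
Proof. by rewrite mulr_sumr; apply: eq_bigr => i _; rewrite !mxE mulrA. Qed.

Lemma dotZr d c (u w : 'rV[R]_d) : dot u (c *: w) = c * dot u w.
Proof. by rewrite mulr_sumr; apply: eq_bigr => i _; rewrite !mxE mulrCA. Qed.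

(** Young's inequality summed over coordinates after scaling [w] to norm 1. This form of Hölder's
    inequality yields both [dot_le_pnorm] and [psum_ge1]. *)
Lemma dot_le d (u w : 'rV[R]_d) : 0 < pnorm p w ->
  dot u w <= (psum q u / q + p^-1) * pnorm p w.
Proof.
move=> w0; set N := pnorm p w in w0 *.
rewrite -ler_pdivrMr // [leLHS]mulr_suml.
have -> : p^-1 = psum p w / N `^ p / p.
  rewrite pnorm_psum divff ?mul1r // -pnorm_psum.
  exact: lt0r_neq0 (powR_gt0 _ w0).
rewrite !mulr_suml -big_split /=; apply: ler_sum => i _.
have qp1 : q^-1 + p^-1 = 1 by rewrite addrC.
have -> : u 0 i * w 0 i / N = u 0 i * (w 0 i / N) by rewrite mulrA.
apply: le_trans (young _ _ q0 p0 qp1) _.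
by rewrite normrM normfV (gtr0_norm w0) powR_div // ltW.
Qed.

Lemma dot_le_pnorm d (u w : 'rV[R]_d) : psum q u <= 1 -> dot u w <= pnorm p w.
Proof.
move=> u1; have := pnorm_ge0 w; rewrite le_eqVlt => /orP[/eqP/esym w0|w0].
  rewrite w0 (pnorm0_eq0 w0) /dot big1 // => i _.
  by rewrite mxE mulr0.
apply: le_trans (dot_le u w0) _; rewrite -[leRHS]mul1r ler_pM2r //.
by rewrite -pq1 addrC lerD2l -[leRHS]mul1r ler_pM2r ?invr_gt0.
Qed.

Lemma psum_ge1 d (u w : 'rV[R]_d) : 0 < pnorm p w -> pnorm p w <= dot u w ->
  1 <= psum q u.
Proof.
move=> w0 uw; have := le_trans uw (dot_le u w0).
rewrite -[leLHS]mul1r ler_pM2r // => H.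
have : q^-1 <= psum q u / q by move: pq1 H; lra.
by rewrite -[leLHS]mul1r ler_pM2r // invr_gt0.
Qed.

(** The vector at which Hölder's inequality for [u] is an equality. *)
Definition dual d (u : 'rV[R]_d) : 'rV[R]_d := \row_i spow (q - 1) (u 0 i).

Lemma dot_dual d (u : 'rV[R]_d) : dot u (dual u) = psum q u.
Proof. by apply: eq_bigr => i _; rewrite mxE mulrC spowM. Qed.

Lemma psum_dual d (u : 'rV[R]_d) : psum p (dual u) = psum q u.
Proof.
apply: eq_bigr => i _; rewrite mxE norm_spow; last by move: q2; lra.
by rewrite -powRrM qq.
Qed.

(** Testing on [dual u] gives S^p <= S for S = [psum q u], which fails for S > 1. *)
Lemma psum_le1 d (u : 'rV[R]_d) :
  (forall w, dot u w <= pnorm p w) -> psum q u <= 1.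
Proof.
move=> /(_ (dual u)); rewrite dot_dual => H.
rewrite leNgt; apply/negP => u1.
have : psum q u `^ p <= psum q u.
  rewrite -[leRHS]psum_dual -pnorm_psum; apply: ge0_ler_powR => //.
  - exact: ltW.
  - exact: psum_ge0.
  - exact: pnorm_ge0.
rewrite -[leRHS]powRr1 ?psum_ge0 // leNgt => /negP[].
rewrite /powR gt_eqF; last by move: u1; lra.
by rewrite ltr_expR ltr_pM2r // ln_gt0.
Qed.

(** For nonzero [a], the gradient of the l_p norm at [a], that is, its norming functional. *)
Definition normal d (a : 'rV[R]_d) : 'rV[R]_d :=
  (pnorm p a `^ (p - 1))^-1 *: \row_i spow (p - 1) (a 0 i).

Lemma dot_normal d (a : 'rV[R]_d) : 0 < pnorm p a -> dot (normal a) a = pnorm p a.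
Proof.
move=> a0; rewrite dotZl.
have -> : dot (\row_i spow (p - 1) (a 0 i)) a = psum p a.
  by apply: eq_bigr => i _; rewrite mxE spowM.
rewrite -pnorm_psum -[in X in _ * X](mulr_powRB1 (ltW a0) p0) mulrCA mulVf ?mulr1 //.
exact: lt0r_neq0 (powR_gt0 _ a0).
Qed.

(** [powR_smooth] summed over coordinates controls the p-th power of the norm; the tangent to t^p at
    the norm of [a] removes the power. *)
Lemma pnorm_smooth d (a v : 'rV[R]_d) : 0 < pnorm p a ->
  pnorm p (a + v) <=
  pnorm p a + dot (normal a) v + 2 * psum p v / pnorm p a `^ (p - 1).
Proof.
rewrite /normal dotZl; set D := dot _ v.
have : psum p (a + v) <= psum p a + p * D + 2 * p * psum p v.
  rewrite /D /dot !mulr_sumr -!big_split /=; apply: ler_sum => i _.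
  by rewrite !mxE mulrA; apply: powR_smooth => //; exact: ltW.
move: (pnorm_psum a) (pnorm_psum (a + v)) (pnorm_ge0 (a + v)).
move: (pnorm p a) (pnorm p (a + v)) (psum p a) (psum p (a + v)) (psum p v) D.
move=> N Y _ _ V D <- <- Y0 S N0.
have := powR_tangent Y N p1.
rewrite /spow (gtr0_sg N0) mul1r (gtr0_norm N0) (ger0_norm Y0).
have : 0 < N `^ (p - 1) by exact: powR_gt0.
move: (N `^ (p - 1)) (N `^ p) (Y `^ p) S => M Np Yp S M0 T.
have {T S} : p * M * (Y - N) <= p * (D + 2 * V) by move: S T; lra.
rewrite -mulrA ler_pM2l // -ler_pdivlMl // mulrDr [_ * (2 * _)]mulrC.
by lra.
Qed.

Lemma normal_dual_bound d (I : finType) (A : {set I}) (a : I -> 'rV[R]_d) w :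
    (forall i, i \in A -> 0 < pnorm p (a i)) ->
    (forall t : R, 0 <= \sum_(i in A) (pnorm p (a i - t *: w) - pnorm p (a i))
                    + pnorm p (t *: w)) ->
  \sum_(i in A) dot (normal (a i)) w <= pnorm p w.
Proof.
move=> apos H.
pose C := \sum_(i in A) 2 * psum p w / pnorm p (a i) `^ (p - 1).
have C0 : 0 <= C.
  apply: sumr_ge0 => i _; rewrite divr_ge0 ?powR_ge0 //.
  by rewrite mulr_ge0 ?psum_ge0.
(* Moving by [t *: w] leaves a remainder of order t^p; divided by t it has order t^(p-1) and
   vanishes as t tends to 0. *)
apply: (ler_powR_addeps p10 C0) => t t0.
have := H t; rewrite pnormZ ?(ltW p1) // (gtr0_norm t0) => Ht.
have : \sum_(i in A) (pnorm p (a i - t *: w) - pnorm p (a i)) <=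
    \sum_(i in A) (- t * dot (normal (a i)) w
       + t `^ p * (2 * psum p w / pnorm p (a i) `^ (p - 1))).
  apply: ler_sum => i iA; rewrite lerBlDl addrA -scaleNr.
  apply: le_trans (pnorm_smooth _ (apos i iA)) _.
  by rewrite dotZr psumZ normrN (gtr0_norm t0) mulrCA !mulrA.
have -> : \sum_(i in A) (- t * dot (normal (a i)) w
       + t `^ p * (2 * psum p w / pnorm p (a i) `^ (p - 1))) =
    - t * \sum_(i in A) dot (normal (a i)) w + t * t `^ (p - 1) * C.
  by rewrite mulr_powRB1 ?(ltW t0) // /C !mulr_sumr big_split.
move=> S; rewrite -(ler_pM2l t0); move: Ht S.
move: (bigop _ _ _) (bigop _ _ _) => s s'; lra.
Qed.
End FiniteLp.

(** * Functionals with bounded subset sums *)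

Section DualFamily.
Variables (R : realType) (p q : R).
Hypothesis p1 : 1 < p.
Hypothesis p2 : p < 2.
Hypothesis qE : q * (p - 1) = p.

Let p10 : 0 < p - 1. Proof. by rewrite subr_gt0. Qed.
Let q2 : 2 < q. Proof. by rewrite -(ltr_pM2r p10) qE; move: p2; lra. Qed.
Let q1 : 1 < q. Proof. by move: q2; lra. Qed.

Lemma psum_clarkson d (x y : 'rV[R]_d) :
  2 * (psum q x + psum q y) <= psum q (x + y) + psum q (x - y).
Proof.
rewrite -!big_split mulr_sumr; apply: ler_sum => i _ /=.
by rewrite !mxE; exact: powR_clarkson.
Qed.

Lemma psum_sub_le d (x y : 'rV[R]_d) :
  psum q (x - y) <= 2 `^ (q - 1) * (psum q x + psum q y).
Proof.
rewrite -!big_split mulr_sumr; apply: ler_sum => i _ /=.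
by rewrite !mxE; exact: powR_midpoint.
Qed.

(** The signs are chosen greedily: by Clarkson's inequality, adding or subtracting the next vector
    raises [psum q] by at least its own [psum q]. *)
Lemma psum_signs d (I : finType) (u : I -> 'rV[R]_d) (s : seq I) : uniq s ->
  exists eps : I -> bool,
    \sum_(i <- s) psum q (u i) <= psum q (\sum_(i <- s) (-1) ^+ eps i *: u i).
Proof.
elim: s => [_|i s IH /= /andP[is_ us]].
  by exists xpredT; rewrite !big_nil psum_ge0.
have [eps H] := IH us; pose V := \sum_(i <- s) (-1) ^+ eps i *: u i.
have := psum_clarkson V (u i).
have E (b : bool) : \sum_(j <- i :: s) (-1) ^+ (if j == i then b else eps j) *: u j =
    V + (-1) ^+ b *: u i.
  rewrite big_cons eqxx addrC; congr (_ + _).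
  by apply: eq_big_seq => j js; case: eqP => // ji; rewrite -ji js in is_.
rewrite big_cons => C.
have [h|h] := leP (psum q (u i) + psum q V) (psum q (V + u i)).
  exists (fun j => if j == i then false else eps j); rewrite E expr0 scale1r.
  by move: H h; rewrite -/V; lra.
exists (fun j => if j == i then true else eps j); rewrite E expr1 scaleN1r.
by move: H h C; rewrite -/V; lra.
Qed.

Variables (n d : nat) (u a : 'I_n -> 'rV[R]_d).
Hypothesis sub_le : forall (A : {set 'I_n}) w,
  \sum_(i in A) dot (u i) w <= pnorm p w.
Hypothesis a_gt0 : forall i, 0 < pnorm p (a i).
Hypothesis u_a : forall i, dot (u i) (a i) = pnorm p (a i).

Let subset_psum (A : {set 'I_n}) : psum q (\sum_(i in A) u i) <= 1.
Proof.
by apply: (psum_le1 p1 p2 qE) => w; rewrite -dot_suml.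
Qed.

Let unit_psum i : 1 <= psum q (u i).
Proof. by apply: (psum_ge1 p1 p2 qE (a_gt0 i)); rewrite u_a. Qed.

Lemma family_size_powR : n%:R <= 2 `^ q.
Proof.
have [eps H] := psum_signs u (index_enum_uniq 'I_n).
have : n%:R <= \sum_i psum q (u i).
  by rewrite -[in leLHS](card_ord n) -sumr_const; apply: ler_sum => i _.
move=> /le_trans/(_ H)/le_trans; apply.
have -> : \sum_i (-1) ^+ eps i *: u i =
    \sum_(i in [set i | ~~ eps i]) u i - \sum_(i in [set i | eps i]) u i.
  rewrite (bigID eps) /= addrC -sumrN; congr (_ + _); apply: eq_big => i; rewrite ?inE //.
    by move=> /negPf ->; rewrite expr0 scale1r.
  by move=> ->; rewrite expr1 scaleN1r.
apply: le_trans (psum_sub_le _ _) _.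
have -> : 2 `^ q = 2 `^ (q - 1) * 2 :> R by rewrite mulrC mulr_powRB1 //; move: q1; lra.
rewrite ler_pM2l ?powR_gt0 //.
by have := lerD (subset_psum [set i | ~~ eps i]) (subset_psum [set i | eps i]); lra.
Qed.

(* If [u j] vanished at [a i], both [u i] and [u i + u j] would norm [a i],
   against uniform convexity of the dual norm. *)
Let obtuse i j : i != j -> dot (u j) (a i) < 0.
Proof.
move=> ij; rewrite ltNge; apply/negP => ge0.
have uij : psum q (u i + u j) <= 1.
  by have := subset_psum [set i; j]; rewrite big_setU1 ?inE //= big_set1.
have ui : psum q (u i) <= 1.
  by have := subset_psum [set i]; rewrite big_set1.
(* Half-sum and half-difference of [u i + u j] and [u i]. Clarkson's inequality bounds psum x + psum
   y by 1, yet [x] still norms [a i] and [y] is nonzero. *)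
pose x := 2^-1 *: ((u i + u j) + u i); pose y := 2^-1 *: u j.
have xy : x + y = u i + u j.
  by apply/rowP => k; rewrite !mxE; field.
have xBy : x - y = u i.
  by apply/rowP => k; rewrite !mxE; field.
have := psum_clarkson x y; rewrite xy xBy.
have : 1 <= psum q x.
  apply: (psum_ge1 p1 p2 qE (a_gt0 i)).
  by rewrite dotZl !dotDl u_a; move: ge0; lra.
have : 0 < psum q y.
  rewrite psumZ mulr_gt0 ?(lt_le_trans ltr01 (unit_psum j)) // powR_gt0 //.
  by rewrite normr_gt0.
by move: uij ui; lra.
Qed.

(** The subset bound for all indices but [i], tested at [- a i]. *)
Let row_sum i : \sum_(j | j != i) - dot (u j) (a i) <= pnorm p (a i).
Proof.
have := sub_le [set~ i] (- a i).
rewrite -scaleN1r pnormZ ?(ltW p1) // normrN1 mul1r.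
congr (_ <= _); apply: eq_big => j; first by rewrite !inE.
by rewrite dotZr mulN1r.
Qed.

(* The Gram-like matrix [dot (u j) (a i)] has strictly negative off-diagonal
   entries and nonnegative row sums, so only constant vectors can be in its kernel. *)
Let no_relation (c : 'I_n -> R) (i0 : 'I_n) :
  c i0 = 0 -> \sum_j c j *: u j = 0 -> forall j, c j = 0.
Proof.
move=> c0 rel.
have [i _ imax] := @arg_maxP _ R 'I_n i0 xpredT (fun j => `|c j|) isT.
suff ci : c i = 0 by move=> j; apply/eqP; rewrite -normr_le0 -(normr0 R) -ci; exact: imax.
apply/eqP; apply: contraT => cin.
have i0i : i0 != i by apply: contra_neq cin => <-.
have cpos : 0 < `|c i| by rewrite normr_gt0.
have E : \sum_j c j * dot (u j) (a i) = 0.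
  rewrite -(eq_bigr _ (fun j _ => dotZl (c j) (u j) (a i))).
  by rewrite dot_suml rel dot0l.
move: E; rewrite (bigD1 i) //= u_a => E.
have : `|c i| * pnorm p (a i) <= \sum_(j | j != i) `|c j| * - dot (u j) (a i).
  rewrite -[pnorm p (a i)]gtr0_norm // -normrM.
  have -> : c i * pnorm p (a i) = - \sum_(j | j != i) c j * dot (u j) (a i).
    by move: E; set s := bigop _ _ _; lra.
  rewrite normrN; apply: le_trans (ler_norm_sum _ _ _) _.
  apply: ler_sum => j ji; rewrite normrM (ltr0_norm (obtuse _)) // eq_sym //.
rewrite leNgt => /negP[].
(* Every |c j| is at most the maximum |c i|, strictly so at [i0], where [c] vanishes. *)
apply: (@lt_le_trans _ _ (\sum_(j | j != i) `|c i| * - dot (u j) (a i))).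
  rewrite [ltLHS](bigD1 i0) //= [ltRHS](bigD1 i0) //= c0 normr0 mul0r.
  apply: ltr_leD; first by rewrite mulr_gt0 // oppr_gt0 obtuse // eq_sym.
  apply: ler_sum => j /andP[ji _]; rewrite ler_wpM2r //; last exact: imax.
  by rewrite oppr_ge0 ltW // obtuse // eq_sym.
by rewrite -mulr_sumr ler_pM2l // row_sum.
Qed.

Lemma family_size_dim : (n <= d.+1)%N.
Proof.
rewrite leqNgt; apply/negP => dn.
case: n u a sub_le a_gt0 u_a no_relation dn => // m v b _ _ _ norel dm.
pose B : 'M[R]_(m, d) := \matrix_(i, j) v (lift ord0 i) 0 j.
have : kermx B != 0.
  rewrite kermx_eq0 /row_free neq_ltn; apply/orP; left.
  exact: leq_ltn_trans (rank_leq_col B) dm.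
move=> /rowV0Pn[x /sub_kermxP xB xn0].
(* A relation among the last m vectors becomes one among all m + 1 with coefficient 0 at [ord0],
   which [no_relation] excludes. *)
pose c (i : 'I_m.+1) := if unlift ord0 i is Some j then x 0 j else 0.
have rel : \sum_j c j *: v j = 0.
  rewrite big_ord_recl /c unlift_none scale0r add0r.
  under eq_bigr => j _ do rewrite liftK.
  apply/rowP => k; have := congr1 (fun y : 'rV[R]_d => y 0 k) xB.
  rewrite [in X in X -> _]mxE summxE mxE => xBk; rewrite -[RHS]xBk.
  by apply: eq_bigr => j _; rewrite !mxE.
have c0 : c ord0 = 0 by rewrite /c unlift_none.
move/negP: xn0; apply; apply/eqP/rowP => j; rewrite mxE.
by have := norel c ord0 c0 rel (lift ord0 j); rewrite /c liftK.
Qed.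
End DualFamily.

(** * The extremal family of functionals *)

Section SimplexFamily.
Variables (R : realType) (p q : R).
Hypothesis p1 : 1 < p.
Hypothesis p2 : p < 2.
Hypothesis qE : q * (p - 1) = p.
Variables (n d : nat).
Hypothesis n2 : (2 <= n)%N.
Hypothesis nd : (n <= d)%N.

Let p10 : 0 < p - 1. Proof. by rewrite subr_gt0. Qed.
Let q2 : 2 < q. Proof. by rewrite -(ltr_pM2r p10) qE; move: p2; lra. Qed.
Let qn0 : q != 0. Proof. by rewrite gt_eqF //; move: q2; lra. Qed.

Definition pad (x : 'I_n -> R) : 'rV[R]_d :=
  \row_(j < d) oapp x 0 (insub (val j)).

Let psum_pad r x : r != 0 -> psum r (pad x) = \sum_j `|x j| `^ r.
Proof.
move=> r0; rewrite /psum (bigID (fun j : 'I_d => (j < n)%N)) /=.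
rewrite [X in _ + X]big1 ?addr0 => [|j jn]; last first.
  by rewrite mxE insubF ?(negbTE jn) //= normr0 powR0.
rewrite (reindex_omap (widen_ord nd) (fun j : 'I_d => insub (val j))) /=.
  apply: eq_big => [j|j _]; last by rewrite mxE /= valK.
  by rewrite ltn_ord valK /= eqxx.
move=> j jn; rewrite insubT /=; congr Some; exact: val_inj.
Qed.

Let sum_pad (P : pred 'I_n) (x : 'I_n -> 'I_n -> R) :
  \sum_(i | P i) pad (x i) = pad (fun j => \sum_(i | P i) x i j).
Proof.
apply/rowP => j; rewrite summxE mxE; under eq_bigr do rewrite mxE.
by case: insub => //=; rewrite big1.
Qed.

(* The [q]-th power of the [l_q] norm of a sum of [k] of the [n] vectors
   [n e_i - (1, ..., 1)]. *)
Definition simplex_defect (k : nat) : R :=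
  k%:R * (n%:R - k%:R) `^ q + (n%:R - k%:R) * k%:R `^ q.

Let S := simplex_defect 1.
(** Scales the vectors to unit l_q norm, since [S] is the q-th power of the norm of one n e_i - (1,
    ..., 1). *)
Let c := S `^ (- q^-1).

Let S_gt0 : 0 < S.
Proof.
have : 0 < n%:R - 1 :> R by rewrite subr_gt0 ltr1n.
by move=> h; rewrite /S /simplex_defect mul1r powR1 mulr1 addr_gt0 // powR_gt0.
Qed.

Let cq : c `^ q = S^-1.
Proof. by rewrite /c -powRrM mulNr mulVf // powR_inv1 // ltW. Qed.

Definition simplex (i : 'I_n) : 'rV[R]_d :=
  pad (fun j => c * ((i == j)%:R * n%:R - 1)).

Let psum_simplex (A : {set 'I_n}) :
  psum q (\sum_(i in A) simplex i) = simplex_defect #|A| / S.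
Proof.
rewrite /simplex sum_pad psum_pad //.
(* Coordinate j of the sum is c (n - |A|) when j is in A, and -c |A| otherwise. *)
have E j : `|\sum_(i in A) c * ((i == j)%:R * n%:R - 1)| `^ q =
    S^-1 * (if j \in A then (n%:R - #|A|%:R) `^ q else #|A|%:R `^ q).
  rewrite -mulr_sumr normrM powRM // (ger0_norm (powR_ge0 _ _)) cq; congr (_ * _).
  rewrite sumrB sumr_const -mulr_suml.
  have -> : \sum_(i in A) (i == j)%:R = (j \in A)%:R :> R.
    case: (boolP (j \in A)) => jA; last first.
      by apply: big1 => i iA; case: eqP => // ij; rewrite -ij iA in jA.
    by rewrite (bigD1 j) //= eqxx big1 ?addr0 // => i /andP[_ /negPf ->].
  case: ifP => _; rewrite ?mul1r ?mul0r ?sub0r ?normrN ger0_norm //.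
  by rewrite subr_ge0 ler_nat -[leqRHS](card_ord n) max_card.
under eq_bigr => j _ do rewrite E.
rewrite -mulr_sumr mulrC; congr (_ * _).
rewrite (bigID (mem A)) /= /simplex_defect; congr (_ + _).
  under eq_bigr => j jA do rewrite jA.
  by rewrite sumr_const mulr_natl.
under eq_bigr => j /negPf jA do rewrite jA.
rewrite sumr_const -natrB ?mulr_natl; last by rewrite -[leqRHS](card_ord n) max_card.
congr (_ *+ _); have := cardC A; rewrite card_ord.
set m := #|[predC A]|; have -> : m = #|(fun i => i \notin A)|.
  by apply: eq_card => j; rewrite !inE.
exact: (canRL (addKn _)).
Qed.

Hypothesis defect_max : forall k, (k <= n)%N -> simplex_defect k <= simplex_defect 1.

Lemma simplex_subset (A : {set 'I_n}) w :
  \sum_(i in A) dot (simplex i) w <= pnorm p w.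
Proof.
rewrite dot_suml; apply: (dot_le_pnorm p1 p2 qE).
rewrite psum_simplex ler_pdivrMr // mul1r defect_max //.
by rewrite -[leqRHS](card_ord n) max_card.
Qed.

Let psum_simplex1 i : psum q (simplex i) = 1.
Proof.
have := psum_simplex [set i]; rewrite big_set1 cards1 divff //.
exact: lt0r_neq0.
Qed.

Lemma simplex_dual i : dot (simplex i) (dual q (simplex i)) = 1.
Proof. by rewrite (dot_dual p1 p2 qE) psum_simplex1. Qed.

Lemma pnorm_simplex i : pnorm p (dual q (simplex i)) = 1.
Proof.
rewrite /pnorm -/(psum p (dual q (simplex i))) (psum_dual p1 p2 qE).
by rewrite psum_simplex1 powR1.
Qed.

Lemma simplex_sum0 w : \sum_i dot (simplex i) w = 0.
Proof.
rewrite dot_suml /simplex sum_pad.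
have -> : (fun j : 'I_n => \sum_i c * ((i == j)%:R * n%:R - 1)) = fun=> 0.
  apply/funext => j; rewrite -mulr_sumr sumrB sumr_const card_ord -mulr_suml.
  by rewrite (bigD1 j) //= eqxx big1 ?addr0 ?mul1r ?subrr ?mulr0 // => i /negPf ->.
apply: big1 => j _; rewrite mxE.
by case: insub => [k|] /=; rewrite mul0r.
Qed.
End SimplexFamily.

(** * Unimodality of the simplex inequality *)

Section Unimodality.
Variable R : realType.
Implicit Types (a b c e x y t q : R).

Lemma MVT_is_derive (f df : R -> R) a b : a < b ->
    (forall x, a <= x <= b -> is_derive x 1 f (df x)) ->
  exists c, [/\ a < c, c < b & f b - f a = df c * (b - a)].
Proof.
move=> ab D.
have [|x xab|c] := @MVT R f df a b ab.
- by move=> x; rewrite in_itv /= => /andP[ax xb]; apply: D; rewrite !ltW.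
- apply: derivable_within_continuous => y; rewrite in_itv /= => yab.
  by have [] := D y yab.
by rewrite in_itv /= => /andP[ac cb] E; exists c.
Qed.

Variable q : R.
Hypothesis q2 : 2 < q.

Let q0 : 0 < q. Proof. exact: lt_trans q2. Qed.
Let q10 : 0 < q - 1. Proof. by move: q2; lra. Qed.
Let q20 : 0 < q - 2. Proof. by move: q2; lra. Qed.

(** Equals [simplex_defect q n k] divided by n^(q+1) at x = k / n, so different n are compared
    through one function. *)
Definition mixed x : R := x * (1 - x) `^ q + (1 - x) * x `^ q.

Let dmixed x : R := (1 - x) `^ q - q * x * (1 - x) `^ (q - 1)
  + q * (1 - x) * x `^ (q - 1) - x `^ q.

Let mixed_derive x : 0 < x -> x < 1 -> is_derive x 1 mixed (dmixed x).
Proof.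
move=> x0 x1.
have y0 : 0 < 1 - x by rewrite subr_gt0.
have d1 : is_derive x 1 (fun y : R => 1 - y) (-1).
  apply: (is_derive_eq (is_deriveB (is_derive_cst (1 : R) x 1) (is_derive_id x 1))).
  by rewrite sub0r.
have d2 : is_derive x 1 (fun y : R => (1 - y) `^ q) (q * (1 - x) `^ (q - 1) * -1).
  have := @is_derive1_comp R (fun y : R => y `^ q) (fun y : R => 1 - y) x _ _ (is_derive1_powR q y0) d1.
  exact.
have d3 := is_derive1_powR q x0.
have d4 := is_deriveM (is_derive_id x 1) d2.
have d5 := is_deriveM d1 d3.
apply: (is_derive_eq (is_deriveD d4 d5)).
by rewrite /dmixed /GRing.scale /=; ring.
Qed.

(* [dmixed x] has the sign of [slope (x / (1 - x))]. *)
Let slope t : R := 1 - q * t + q * t `^ (q - 1) - t `^ q.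
Let hump t : R := t `^ (q - 2) * (q - 1 - t).

Let slope_derive t : 0 < t -> is_derive t 1 slope (q * (hump t - 1)).
Proof.
move=> t0.
have d1 := is_deriveZ q (is_derive_id t 1).
have d2 := is_deriveZ q (is_derive1_powR (q - 1) t0).
have d3 := is_derive1_powR q t0.
have d4 := is_deriveB (is_derive_cst (1 : R) t 1) d1.
apply: (is_derive_eq (is_deriveB (is_deriveD d4 d2) d3)).
rewrite /hump /GRing.scale /= -(mulr_powRB1 (ltW t0) q10).
have -> : q - 1 - 1 = q - 2 by ring.
by ring.
Qed.

(** Both factors are bounded by exponentials, with exponents (q - 2)(t - 1) and q - 2 - t; their sum
    is (q - 3) t <= 0. *)
Let hump_le1 t : q <= 3 -> 0 < t -> t <= 1 -> hump t <= 1.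
Proof.
move=> q3 t0 t1; rewrite /hump /powR gt_eqF //.
have h : q - 1 - t <= expR (q - 2 - t).
  by have := expR_ge1Dx (q - 2 - t); lra.
have h0 : 0 <= q - 1 - t by move: q2; lra.
have l : (q - 2) * ln t <= (q - 2) * (t - 1).
  rewrite ler_wpM2l ?(ltW q20) // lerBrDl.
  have : ln t <= t - 1 by rewrite -[X in ln X](subrKC 1 t) le_ln1Dx //; lra.
  by lra.
apply: le_trans (ler_pM _ _ _ h) _; rewrite ?expR_ge0 //.
rewrite -expRD -[leRHS]expR0 ler_expR.
apply: le_trans (lerD l (lexx _)) _.
have : 0 <= (3 - q) * t by rewrite mulr_ge0 ?subr_ge0 // ltW.
by lra.
Qed.

(** Write [hump] as t^(q-3) times t (q - 1 - t); both factors are nondecreasing on (0, 1]. *)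
Let hump_mono s t : 3 <= q -> 0 < s -> s <= t -> t <= 1 -> hump s <= hump t.
Proof.
move=> q3 s0 st t1; have t0 : 0 < t by exact: lt_le_trans st.
have E u : 0 < u -> hump u = u `^ (q - 3) * (u * (q - 1 - u)).
  move=> u0; rewrite /hump -(mulr_powRB1 (ltW u0) q20).
  have -> : q - 2 - 1 = q - 3 by ring.
  by ring.
rewrite !E //; apply: ler_pM; rewrite ?powR_ge0 //.
- by rewrite mulr_ge0 ?(ltW s0) //; lra.
- by apply: ge0_ler_powR; rewrite ?nnegrE ?(ltW s0) ?(ltW t0) //; lra.
have : 0 <= (t - s) * (q - 1 - s - t) by rewrite mulr_ge0 //; lra.
by lra.
Qed.

(** For q <= 3 [slope] is nonincreasing. For q >= 3 its derivative is nondecreasing, so it is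
    convex, and being nonpositive at s and zero at 1 it stays nonpositive in between. *)
Let slope_stays s t : 0 < s -> s <= t -> t <= 1 -> slope s <= 0 -> slope t <= 0.
Proof.
move=> s0 + + Ns; rewrite le_eqVlt => /orP[/eqP <- //|st].
have t0 : 0 < t by exact: lt_trans st.
rewrite le_eqVlt => /orP[/eqP ->|t1]; first by rewrite /slope !powR1; lra.
have D x y z : 0 < x -> x <= z <= y -> is_derive z 1 slope (q * (hump z - 1)).
  by move=> x0 /andP[xz _]; apply: slope_derive; exact: lt_le_trans xz.
have [c [sc ct E]] := MVT_is_derive st (fun z => D s t z s0).
have [q3|/ltW q3] := leP q 3.
  have : (1 - hump c) * (q * (t - s)) >= 0.
    rewrite mulr_ge0 ?subr_ge0 ?hump_le1 ?mulr_ge0 ?subr_ge0 ?(ltW st) ?(ltW q0) //.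
      exact: lt_trans sc.
    by lra.
  by move: E Ns; lra.
rewrite leNgt; apply/negP => Nt.
have [c' [tc c1 E']] := MVT_is_derive t1 (fun z => D t 1 z t0).
have S1 : slope 1 = 0 by rewrite /slope !powR1; ring.
have h : hump c <= hump c' by apply: hump_mono => //; lra.
have : 0 <= q * (t - s) by rewrite mulr_ge0 ?(ltW q0) ?subr_ge0 ?ltW.
have : 0 <= q * (1 - t) by rewrite mulr_ge0 ?(ltW q0) ?subr_ge0 ?ltW.
have H1 : hump c' < 1.
  rewrite ltNge; apply/negP => h1.
  have : 0 <= q * (hump c' - 1) * (1 - t).
    by rewrite !mulr_ge0 ?subr_ge0 ?(ltW q0) ?(ltW t1).
  by rewrite -E' S1; lra.
have : 0 <= (1 - hump c) * (q * (t - s)).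
  by rewrite mulr_ge0 ?mulr_ge0 ?(ltW q0) ?subr_ge0 ?(ltW st) //; lra.
by move: E Ns Nt; lra.
Qed.

Let dmixedE x : 0 < x -> x < 1 ->
  dmixed x = (1 - x) `^ q * slope (x / (1 - x)).
Proof.
move=> x0 x1; have y0 : 0 < 1 - x by rewrite subr_gt0.
rewrite /slope !powR_div ?(ltW x0) // /dmixed.
rewrite -!(mulr_powRB1 (ltW y0) q0) -!(mulr_powRB1 (ltW x0) q0).
have : 0 < (1 - x) `^ (q - 1) by exact: powR_gt0.
move: ((1 - x) `^ (q - 1)) (x `^ (q - 1)) => A B A0.
by field; rewrite !gt_eqF.
Qed.

(** The mean value theorem gives a point of (a, b) with nonpositive derivative; this sign persists
    up to 1/2, because x / (1 - x) increases and stays at most 1 there. *)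
Lemma mixed_unimodal a b c e : 0 < a -> a < b -> b <= c -> c <= e -> e <= 2^-1 ->
  mixed b <= mixed a -> mixed e <= mixed c.
Proof.
move=> a0 ab bc ce e12 ba.
have [x [ax xb E]] : exists x, [/\ a < x, x < b
    & mixed b - mixed a = dmixed x * (b - a)].
  by apply: MVT_is_derive => // x /andP[ax xb]; apply: mixed_derive; lra.
have dx : dmixed x <= 0.
  by rewrite -(ler_pM2r (_ : 0 < b - a)) ?subr_gt0 // -E mul0r subr_le0.
move: ce; rewrite le_eqVlt => /orP[/eqP -> //|ce].
have [y [cy ye E']] : exists y, [/\ c < y, y < e
    & mixed e - mixed c = dmixed y * (e - c)].
  by apply: MVT_is_derive => // y /andP[cy ye]; apply: mixed_derive; lra.
rewrite -subr_le0 E' pmulr_lle0 ?subr_gt0 //.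
have x0 : 0 < x by lra.
have x1 : x < 1 by lra.
have y0 : 0 < y by lra.
have y1 : y < 1 by lra.
rewrite dmixedE // pmulr_rle0 ?powR_gt0 ?subr_gt0 //.
apply: (@slope_stays (x / (1 - x))).
- by rewrite divr_gt0 ?subr_gt0.
- rewrite ler_pdivrMr ?subr_gt0 // mulrAC ler_pdivlMr ?subr_gt0 //.
  by lra.
- by rewrite ler_pdivrMr ?subr_gt0 // mul1r; lra.
by move: dx; rewrite dmixedE // pmulr_rle0 ?powR_gt0 ?subr_gt0.
Qed.

Notation defect := (simplex_defect q).

Lemma simplex_defect_sym n k : (k <= n)%N -> defect n (n - k) = defect n k.
Proof.
move=> kn; rewrite /simplex_defect natrB //.
have -> : n%:R - (n%:R - k%:R) = k%:R :> R by ring.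
by ring.
Qed.

Lemma simplex_defectE n k : (0 < n)%N -> (k <= n)%N ->
  defect n k = n%:R * n%:R `^ q * mixed (k%:R / n%:R).
Proof.
move=> n0 kn; have n0R : 0 < n%:R :> R by rewrite ltr0n.
have -> : n%:R * n%:R `^ q * mixed (k%:R / n%:R) = n%:R * n%:R `^ q *
    (k%:R / n%:R * ((n%:R - k%:R) / n%:R) `^ q +
    (n%:R - k%:R) / n%:R * (k%:R / n%:R) `^ q).
  congr (_ * _); rewrite /mixed.
  by have -> : 1 - k%:R / n%:R = (n%:R - k%:R) / n%:R :> R by field; rewrite gt_eqF.
rewrite !powR_div ?subr_ge0 ?ler_nat ?ler0n //.
have : 0 < n%:R `^ q :> R by exact: powR_gt0.
rewrite /simplex_defect; move: (n%:R `^ q) => N N0.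
by field; rewrite !gt_eqF.
Qed.

Lemma simplex_defect_le n k l : (0 < n)%N -> (k <= n)%N -> (l <= n)%N ->
  (defect n k <= defect n l) = (mixed (k%:R / n%:R) <= mixed (l%:R / n%:R)).
Proof.
move=> n0 kn ln; rewrite !simplex_defectE // ler_pM2l //.
by rewrite mulr_gt0 ?powR_gt0 ?ltr0n.
Qed.

Lemma simplex_defect_max n k : (2 <= n)%N -> defect n 2 <= defect n 1 ->
  (k <= n)%N -> defect n k <= defect n 1.
Proof.
move=> n2 h kn; wlog k2 : k kn / (k.*2 <= n)%N => [wl|].
  have [|lt] := leqP k.*2 n; first exact: wl.
  by rewrite -simplex_defect_sym // wl //; lia.
have [->|k0] := posnP k.
  rewrite {1}/simplex_defect mul0r powR0 ?mulr0 ?addr0 ?gt_eqF //.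
  rewrite /simplex_defect addr_ge0 ?mulr_ge0 ?powR_ge0 ?ler0n //.
  by rewrite subr_ge0 ler_nat; lia.
have [k1|k1] := leqP k 1; first by have -> : k = 1%N by lia.
apply: le_trans (h); rewrite simplex_defect_le //; last by lia.
have n0 : 0 < n%:R :> R by rewrite ltr0n; lia.
(* The decrease from 1/n to 2/n propagates from 2/n to k/n, which is at most 1/2 by the symmetry
   reduction. *)
apply: (@mixed_unimodal (1 / n%:R) (2 / n%:R)) => //.
- by rewrite divr_gt0.
- by rewrite ltr_pM2r ?invr_gt0 // ltr1n.
- by rewrite ler_pM2r ?invr_gt0 // (ler_nat R 2).
- rewrite ler_pdivrMr // mulrC ler_pdivlMr // -natrM ler_nat; lia.
- by have := h; rewrite simplex_defect_le //; lia.
Qed.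

Lemma simplex_defect_closed m n : (2 <= m)%N -> (m <= n)%N ->
  defect n 2 <= defect n 1 -> defect m 2 <= defect m 1.
Proof.
move=> m2 mn h.
have [m3|m3] := leqP m 3.
  have [->|->] : m = 2%N \/ m = 3%N by lia.
    rewrite /simplex_defect subrr powR0 ?gt_eqF // mulr0 mul0r addr0.
    by rewrite addr_ge0 ?mulr_ge0 ?powR_ge0 // subr_ge0 ler1n.
  by rewrite -(@simplex_defect_sym 3 1).
rewrite leNgt; apply/negP => h'.
have m0 : 0 < m%:R :> R by rewrite ltr0n; lia.
have n0 : 0 < n%:R :> R by rewrite ltr0n; lia.
have mnR : m%:R <= n%:R :> R by rewrite ler_nat.
have m4 : 4 <= m%:R :> R by rewrite (ler_nat _ 4).
move: h h'; rewrite ltNge !simplex_defect_le; try lia.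
have le_inv (c x y : R) : 0 < c -> 0 < x -> x <= y -> c / y <= c / x.
  by move=> c0 x0 xy; rewrite ler_pM2l // lef_pV2 // posrE (lt_le_trans x0).
have aa' : 1%:R / n%:R <= 1%:R / m%:R :> R by apply: le_inv.
have bb' : 2%:R / n%:R <= 2%:R / m%:R :> R by apply: le_inv.
have b'2 : 2%:R / m%:R <= 2^-1 :> R by rewrite ler_pdivrMr //; lra.
have ab : 1%:R / n%:R < 2%:R / n%:R :> R by rewrite ltr_pM2r ?invr_gt0 // ltr1n.
have a0 : 0 < 1%:R / n%:R :> R by rewrite divr_gt0.
have a'b' : 1%:R / m%:R < 2%:R / m%:R :> R by rewrite ltr_pM2r ?invr_gt0 // ltr1n.
move: (1%:R / n%:R) (1%:R / m%:R) (2%:R / n%:R) (2%:R / m%:R) aa' bb' b'2 ab a0 a'b'.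
move=> a a' b b' aa' bb' b'2 ab a0 a'b' h; apply/negP; rewrite negbK.
(* If the intervals [a, b] and [a', b'] overlap, a value at b' above that at a' would force a
   decrease already from a to a', hence also from a' to b'. *)
have [ba'|a'b] := leP b a'; first exact: (@mixed_unimodal a b a' b' _ _ _ (ltW a'b')).
rewrite leNgt; apply/negP => h'.
have hb : mixed b' <= mixed b by apply: (@mixed_unimodal a b b b').
have a'a : mixed a' < mixed a by apply: lt_le_trans h' (le_trans hb h).
move: aa'; rewrite le_eqVlt => /orP[/eqP e|aa']; first by rewrite e ltxx in a'a.
have := @mixed_unimodal a a' a' b' a0 aa' (lexx _) (ltW a'b') b'2 (ltW a'a).
by rewrite leNgt h'.
Qed.

(** Ensures that the maximum defining f exists. For m = n - 1 > 2q, Bernoulli's inequality gives 2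
    (m - 1)^q > m^q, and (m - 1) 2^q > m. *)
Lemma simplex_defect_bound n : (2 <= n)%N -> defect n 2 <= defect n 1 ->
  n%:R <= 2 * q + 1.
Proof.
move=> n2; rewrite /simplex_defect mul1r powR1 mulr1 => h.
rewrite leNgt; apply/negP => nq.
pose m : R := n%:R - 1; have mq : 2 * q < m by rewrite /m; lra.
have m0 : 0 < m by move: q0 mq; lra.
have m4 : 4 < m by move: q2 mq; lra.
have B : 1 - q / m <= (1 - m^-1) `^ q.
  have y0 : 0 <= 1 - m^-1 by rewrite subr_ge0 invf_le1 //; lra.
  have q1 : 1 < q by move: q2; lra.
  have := powR_tangent (1 - m^-1) 1 q1.
  rewrite normr1 powR1 (ger0_norm y0) /spow sgr1 normr1 powR1 => /(le_trans _); apply.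
  by lra.
have Mq : 0 < m `^ q by exact: powR_gt0.
have : 2^-1 < (1 - m^-1) `^ q.
  apply: lt_le_trans B; suff : q / m < 2^-1 by lra.
  by rewrite ltr_pdivrMr //; lra.
have -> : 1 - m^-1 = (m - 1) / m by field; rewrite gt_eqF.
rewrite powR_div ?(ltW m0) //; last by lra.
rewrite ltr_pdivlMr // => H.
move: h; have -> : n%:R - 2 = m - 1 :> R by rewrite /m; ring.
rewrite -/m => h.
have : 2 `^ 2 <= 2 `^ q :> R by apply: ler_powR; rewrite ?ler1n // ltW.
rewrite (powR_mulrn 2 (ler0n _ 2)) => T.
have : (m - 1) * 2 ^+ 2 <= (m - 1) * 2 `^ q by rewrite ler_wpM2l //; lra.
by lra.
Qed.

Lemma simplex_defect_le12 n : (defect n 2 <= defect n 1) =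
  (2 * (n%:R - 2) `^ q + (n%:R - 2) * 2 `^ q <= (n%:R - 1) `^ q + n%:R - 1).
Proof. by rewrite /simplex_defect mul1r powR1 mulr1 addrA. Qed.

End Unimodality.

(** * Existence of the maxima *)

Lemma exists_largest (R : realType) (A : nat -> Prop) (B : R) n0 :
  A n0 -> (forall n, A n -> n%:R <= B) -> exists n, is_largest A n.
Proof.
move=> An0 AB.
have ex : exists n, `[< A n >] by exists n0; apply/asboolP.
have bd n : `[< A n >] -> (n <= Num.truncn B)%N.
  move=> /asboolP An; have nB := AB n An.
  by rewrite truncn_ge_nat // (le_trans _ nB) ?ler0n.
case: (ex_maxnP ex bd) => n /asboolP An nmax.
by exists n; split=> // m Am; apply: nmax; apply/asboolP.
Qed.

Lemma exists_f (R : realType) (q : R) : 2 < q ->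
  exists2 f, is_f q f & (3 <= f)%N.
Proof.
move=> q2; pose A n := (2 <= n)%N /\
  2 * (n%:R - 2) `^ q + (n%:R - 2) * 2 `^ q <= (n%:R - 1) `^ q + n%:R - 1.
have A3 : A 3.
  (* At n = 3 both sides equal 2^q + 2. *)
  split=> //; have -> : 3%:R - 2 = 1 :> R by ring.
  have -> : 3%:R - 1 = 2 :> R by ring.
  by rewrite powR1; lra.
have [n [n2 h]|f ff] := @exists_largest R A (2 * q + 1) 3 A3.
  by apply: simplex_defect_bound => //; rewrite simplex_defect_le12.
by exists f => //; exact: (proj2 ff).
Qed.

(** * Numerical bounds *)

(** A mantissa above 2^64 loses its 16 low bits, which keeps powers with exponents in the thousands
    cheap to compute. *)
Definition roundoff (c P : BinNums.N) (e : nat) : BinNums.N * nat :=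
  if BinNat.N.leb P (BinNat.N.shiftl BinNat.N.one (BinNat.N.of_nat 64)) then (P, e)
  else (BinNat.N.add (BinNat.N.shiftr P (BinNat.N.of_nat 16)) c, (16 + e)%N).
Arguments roundoff : simpl never.

(* [roundpow c a k] is [(M, e)] with [M * 2 ^ e] close to [a ^ k]: the mantissa
   is kept short by rounding, downwards for [c = 0] and upwards for [c = 1]. *)
Fixpoint roundpow (c a : BinNums.N) (k : nat) : BinNums.N * nat :=
  if k is k'.+1 then
    let (M, e) := roundpow c a k' in roundoff c (BinNat.N.mul a M) e
  else (BinNat.N.one, 0%N).

Lemma to_natM a b :
  BinNat.N.to_nat (BinNat.N.mul a b) = (BinNat.N.to_nat a * BinNat.N.to_nat b)%N.
Proof. by rewrite Nnat.N2Nat.inj_mul multE. Qed.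

Lemma roundpow0 a k : let: (M, e) := roundpow BinNums.N0 a k in
  (BinNat.N.to_nat M * 2 ^ e <= BinNat.N.to_nat a ^ k)%N.
Proof.
elim: k => //= k; case: (roundpow BinNums.N0 a k) => M e IH.
have H : (BinNat.N.to_nat (BinNat.N.mul a M) * 2 ^ e <= BinNat.N.to_nat a ^ k.+1)%N.
  by rewrite to_natM expnS -mulnA leq_mul2l IH orbT.
rewrite /roundoff; case: ifP => // _; apply: leq_trans H; rewrite expnD mulnA leq_mul2r.
apply/orP; right; rewrite BinNat.N.add_0_r BinNat.N.shiftr_div_pow2.
have := BinNat.N.Div0.mul_div_le (BinNat.N.mul a M) (BinNat.N.pow BinNat.N.two (BinNat.N.of_nat 16)).
move: (BinNat.N.mul a M) => P; have -> : (2 ^ 16)%N = BinNat.N.to_nat (BinNat.N.pow BinNat.N.two (BinNat.N.of_nat 16)).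
  by rewrite Nnat.N2Nat.inj_pow.
move: (BinNat.N.pow BinNat.N.two (BinNat.N.of_nat 16)) => B; move: (BinNat.N.div P B) => Q.
lia.
Qed.

Lemma roundpow1 a k : let: (M, e) := roundpow BinNat.N.one a k in
  (BinNat.N.to_nat a ^ k <= BinNat.N.to_nat M * 2 ^ e)%N.
Proof.
elim: k => //= k; case: (roundpow BinNat.N.one a k) => M e IH.
have H : (BinNat.N.to_nat a ^ k.+1 <= BinNat.N.to_nat (BinNat.N.mul a M) * 2 ^ e)%N.
  by rewrite to_natM expnS -mulnA leq_mul2l IH orbT.
rewrite /roundoff; case: ifP => // _; apply: leq_trans H _; rewrite expnD mulnA leq_mul2r.
apply/orP; right; rewrite BinNat.N.shiftr_div_pow2.
have := BinNat.N.mul_succ_div_gt (BinNat.N.mul a M) (BinNat.N.pow BinNat.N.two (BinNat.N.of_nat 16)).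
move: (BinNat.N.mul a M) => P; have -> : (2 ^ 16)%N = BinNat.N.to_nat (BinNat.N.pow BinNat.N.two (BinNat.N.of_nat 16)).
  by rewrite Nnat.N2Nat.inj_pow.
have : BinNat.N.pow BinNat.N.two (BinNat.N.of_nat 16) <> BinNums.N0 by [].
move: (BinNat.N.pow BinNat.N.two (BinNat.N.of_nat 16)) => B B0 /(_ B0); move: (BinNat.N.div P B) => Q.
rewrite BinNat.N.add_1_r BinNat.N.mul_comm -to_natM; lia.
Qed.

(* A sufficient test for [a ^ i * b ^ j <= c ^ k * d ^ l]. *)
Definition pow_le_test (a i b j c k d l : nat) : bool :=
  let (A, eA) := roundpow BinNat.N.one (BinNat.N.of_nat a) i in
  let (B, eB) := roundpow BinNat.N.one (BinNat.N.of_nat b) j in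
  let (C, eC) := roundpow BinNums.N0 (BinNat.N.of_nat c) k in
  let (D, eD) := roundpow BinNums.N0 (BinNat.N.of_nat d) l in
  BinNat.N.leb
    (BinNat.N.shiftl (BinNat.N.mul A B) (BinNat.N.of_nat ((eA + eB) - (eC + eD))))
    (BinNat.N.shiftl (BinNat.N.mul C D) (BinNat.N.of_nat ((eC + eD) - (eA + eB)))).

Lemma to_nat_shiftl a e :
  BinNat.N.to_nat (BinNat.N.shiftl a (BinNat.N.of_nat e)) = (BinNat.N.to_nat a * 2 ^ e)%N.
Proof.
rewrite BinNat.N.shiftl_mul_pow2 to_natM Nnat.N2Nat.inj_pow Nnat.Nat2N.id.
congr (_ * _)%N; elim: e => //= e ->.
by rewrite expnS; lia.
Qed.

Lemma pow_le_testP a i b j c k d l : pow_le_test a i b j c k d l ->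
  (a ^ i * b ^ j <= c ^ k * d ^ l)%N.
Proof.
rewrite /pow_le_test.
have := roundpow1 (BinNat.N.of_nat a) i; case: roundpow => A eA.
have := roundpow1 (BinNat.N.of_nat b) j; case: roundpow => B eB.
have := roundpow0 (BinNat.N.of_nat c) k; case: roundpow => C eC.
have := roundpow0 (BinNat.N.of_nat d) l; case: roundpow => D eD.
rewrite !Nnat.Nat2N.id => hD hC hB hA /BinNat.N.leb_le h.
have {h} : (BinNat.N.to_nat (BinNat.N.mul A B) * 2 ^ ((eA + eB) - (eC + eD)) <=
    BinNat.N.to_nat (BinNat.N.mul C D) * 2 ^ ((eC + eD) - (eA + eB)))%N.
  by rewrite -!to_nat_shiftl; lia.
(* The test shifts only by the difference of the exponents; multiplying by 2 to their minimum
   restores both. *)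
rewrite -(leq_pmul2r (expn_gt0 2 (minn (eA + eB) (eC + eD)))) -!mulnA -!expnD.
have -> : (eA + eB - (eC + eD) + minn (eA + eB) (eC + eD) = eA + eB)%N by lia.
have -> : (eC + eD - (eA + eB) + minn (eA + eB) (eC + eD) = eC + eD)%N by lia.
have E x y e f : (x * y * 2 ^ (e + f) = (x * 2 ^ e) * (y * 2 ^ f))%N.
  by rewrite expnD mulnACA.
rewrite !to_natM !E => h.
exact: leq_trans (leq_mul hA hB) (leq_trans h (leq_mul hC hD)).
Qed.

(** * Rational bounds on powers, and the defining inequality of f for n from 4 to 8 *)

Section PowerBounds.
Variable R : realType.

Lemma powR_ratE (x m k : nat) : (0 < k)%N ->
  (x%:R `^ (m%:R / k%:R)) ^+ k = (x ^ m)%:R :> R.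
Proof.
move=> k0; rewrite -powR_mulrn ?powR_ge0 // -powRrM divfK ?pnatr_eq0 -?lt0n //.
by rewrite powR_mulrn ?ler0n // natrX.
Qed.

(** The k-th power turns the claim into the integer inequality u^k <= x^m v^k. *)
Lemma powR_rat_ge (u v x m k : nat) : (0 < v)%N -> (0 < k)%N ->
    pow_le_test u k 1 0 x m v k ->
  u%:R / v%:R <= x%:R `^ (m%:R / k%:R) :> R.
Proof.
move=> v0 k0 /pow_le_testP; rewrite muln1 => h; rewrite -(@ler_pXn2r _ k) ?nnegrE ?powR_ge0 ?divr_ge0 ?ler0n //.
rewrite powR_ratE // expr_div_n ler_pdivrMr ?exprn_gt0 ?ltr0n //.
by rewrite -!natrX -natrM ler_nat.
Qed.

Lemma powR_rat_le (u v x m k : nat) : (0 < v)%N -> (0 < k)%N ->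
    pow_le_test x m v k u k 1 0 ->
  x%:R `^ (m%:R / k%:R) <= u%:R / v%:R :> R.
Proof.
move=> v0 k0 /pow_le_testP; rewrite muln1 => h; rewrite -(@ler_pXn2r _ k) ?nnegrE ?powR_ge0 ?divr_ge0 ?ler0n //.
rewrite powR_ratE // expr_div_n ler_pdivlMr ?exprn_gt0 ?ltr0n //.
by rewrite -!natrX -natrM ler_nat.
Qed.

Definition f_cond (q a : R) : Prop :=
  2 * (a - 2) `^ q + (a - 2) * 2 `^ q <= (a - 1) `^ q + a - 1.

(* With [u = (3/2)^s] one has [u <= 2^s <= u^2]. *)
Lemma powR_gap (s D c : R) : 0 <= s -> 0 <= c -> 2 * c <= D ->
  c * (2 `^ s - 1) <= D * (3 `^ s - 2 `^ s).
Proof.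
move=> s0 c0 cD; pose u := (3 / 2) `^ s : R.
have u1 : 1 <= u.
  by rewrite -(powRr0 (3 / 2)); apply: ler_powR => //; lra.
have uw : u <= 2 `^ s by apply: ge0_ler_powR; rewrite ?nnegrE //; lra.
have wu : 2 `^ s <= u * u.
  rewrite -powRM; try lra.
  by apply: ge0_ler_powR; rewrite ?nnegrE //; lra.
have -> : 3 `^ s = 2 `^ s * u :> R.
  by rewrite -powRM; try lra; congr (_ `^ _); field.
move: (2 `^ s) uw wu => w uw wu.
(* Since u + 1 <= 2w and 2c <= D, c (u^2 - 1) is at most D (u - 1) w, the right-hand side. *)
have : c * (w - 1) <= c * ((u - 1) * (u + 1)) by apply: ler_wpM2l => //; lra.
have : c * ((u - 1) * (u + 1)) <= D * ((u - 1) * w).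
  have : c * (u + 1) <= D * w.
    have : 0 <= (D - 2 * c) * w by rewrite mulr_ge0 //; lra.
    have : 0 <= c * (2 * w - u - 1) by rewrite mulr_ge0 //; lra.
    by lra.
  move=> H; have : 0 <= (u - 1) * (D * w - c * (u + 1)) by rewrite mulr_ge0 //; lra.
  by lra.
by lra.
Qed.

(** Multiply the inequality at q0 by 2^(q - q0); [powR_gap] with c = 3 and D = 3^q0 supplies the
    difference. The general case compares 3 with a - 2, which here is only 2. *)
Lemma f_cond4_mono (q0 q : R) : 3 <= q0 -> q0 <= q -> f_cond q0 4 -> f_cond q 4.
Proof.
rewrite /f_cond; have -> : 4 - 2 = 2 :> R by ring.
have -> : 4 - 1 = 3 :> R by ring.
move=> q3 qq; have s0 : 0 <= q - q0 by lra.
have h3 : 3 ^+ 3 <= 3 `^ q0 :> R.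
  by rewrite -powR_mulrn ?ler0n //; apply: ler_powR => //; rewrite (ler_nat R 1 3).
have E (x : R) : 0 < x -> x `^ q = x `^ q0 * x `^ (q - q0).
  by move=> x0; rewrite -powRD ?subrKC // (gt_eqF x0) implybT.
rewrite !E //.
have c0 : 0 <= 3 :> R by lra.
have cD : 2 * 3 <= 3 `^ q0 :> R by lra.
have G := powR_gap s0 c0 cD.
have w0 : 0 <= 2 `^ (q - q0) :> R by exact: powR_ge0.
move=> h; have := ler_wpM2r w0 h.
move: (3 `^ q0) (2 `^ q0) (2 `^ (q - q0)) (3 `^ (q - q0)) G h => A B w t.
by lra.
Qed.

Lemma f_cond_mono (q0 q a : R) : 3 <= q0 -> q0 <= q -> 5 <= a ->
  f_cond q0 a -> f_cond q a.
Proof.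
rewrite /f_cond => q3 qq a5; have s0 : 0 <= q - q0 by lra.
have h2 : 2 ^+ 3 <= 2 `^ q0 :> R.
  by rewrite -powR_mulrn ?ler0n //; apply: ler_powR => //; rewrite (ler_nat R 1 2).
have E (x : R) : 0 < x -> x `^ q = x `^ q0 * x `^ (q - q0).
  by move=> x0; rewrite -powRD ?subrKC // (gt_eqF x0) implybT.
rewrite !E //; try lra.
have w0 : 0 <= 2 `^ (q - q0) :> R by exact: powR_ge0.
have t0 : 3 `^ (q - q0) <= (a - 2) `^ (q - q0).
  by apply: ge0_ler_powR; rewrite ?nnegrE //; lra.
have u0 : (a - 2) `^ (q - q0) <= (a - 1) `^ (q - q0).
  by apply: ge0_ler_powR; rewrite ?nnegrE //; lra.
have P0 : 0 <= (a - 1) `^ q0 by exact: powR_ge0.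
have C8 : (a - 2) * 2 ^+ 3 <= (a - 2) * 2 `^ q0 by apply: ler_wpM2l => //; lra.
(* The inequality at q0, with 2^q0 >= 8, gives D >= 8 (a - 2) - (a - 1) >= 2 (a - 1), as [powR_gap]
   asks. *)
move=> h; pose D := (a - 1) `^ q0 - 2 * (a - 2) `^ q0.
have D0 : 2 * (a - 1) <= D by rewrite /D; lra.
have a1 : 0 <= a - 1 by lra.
have := powR_gap s0 a1 D0.
have := ler_wpM2l P0 u0.
have : D * 3 `^ (q - q0) <= D * (a - 2) `^ (q - q0) by apply: ler_wpM2l => //; lra.
have := ler_wpM2r w0 h; rewrite /D.
move: ((a - 1) `^ q0) ((a - 2) `^ q0) (2 `^ q0) => P Q B.
move: (2 `^ (q - q0)) (3 `^ (q - q0)) ((a - 2) `^ (q - q0)) ((a - 1) `^ (q - q0)).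
by move=> w t x y; lra.
Qed.

Lemma f_cond4 (q : R) : 321067%:R / 10 ^+ 5 <= q -> f_cond q 4.
Proof.
(* A fraction just below 3.21067. The two bounds that follow fit exactly: 4 * 3268 = 12013 + 3 *
   353. *)
move=> hq; apply: (@f_cond4_mono (1204%:R / 375%:R)); [lra|lra|].
have x1 : 2%:R `^ (1204%:R / 375%:R) <= 3268%:R / 353%:R :> R.
  by apply: powR_rat_le; [by []|by []|vm_compute].
have y1 : 12013%:R / 353%:R <= 3%:R `^ (1204%:R / 375%:R) :> R.
  by apply: powR_rat_ge; [by []|by []|vm_compute].
rewrite /f_cond; have -> : 4 - 2 = 2 :> R by ring.
have -> : 4 - 1 = 3 :> R by ring.
by move: x1 y1; lra.
Qed.

Lemma f_cond5 (q : R) : 340093%:R / 10 ^+ 5 <= q -> f_cond q 5.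
Proof.
move=> hq; apply: (@f_cond_mono (2197%:R / 646%:R)); [lra|lra|lra|].
have x1 : 3697%:R / 350%:R <= 2%:R `^ (2197%:R / 646%:R) :> R.
  by apply: powR_rat_ge; [by []|by []|vm_compute].
have y1 : 3%:R `^ (2197%:R / 646%:R) <= 5117%:R / 122%:R :> R.
  by apply: powR_rat_le; [by []|by []|vm_compute].
rewrite /f_cond; have -> : 5 - 2 = 3 :> R by ring.
have -> : 5 - 1 = 2 * 2 :> R by ring.
rewrite powRM //.
move: (2 `^ _) (3 `^ _) x1 y1 => x y x1 y1.
(* Replaces x^2 - 3x, with x = 2^q, by its value at the lower bound for x. *)
have : 0 <= (x - 3697%:R / 350%:R) * (x + 3697%:R / 350%:R - 3).
  by apply: mulr_ge0; lra.
by lra.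
Qed.

Lemma f_cond6 (q : R) : 369247%:R / 10 ^+ 5 <= q -> f_cond q 6.
Proof.
move=> hq; apply: (@f_cond_mono (1765%:R / 478%:R)); [lra|lra|lra|].
have x1 : 2%:R `^ (1765%:R / 478%:R) <= 4693%:R / 363%:R :> R.
  by apply: powR_rat_le; [by []|by []|vm_compute].
have y1 : 502157%:R / 1318%:R <= 5%:R `^ (1765%:R / 478%:R) :> R.
  by apply: powR_rat_ge; [by []|by []|vm_compute].
rewrite /f_cond; have -> : 6 - 2 = 2 * 2 :> R by ring.
have -> : 6 - 1 = 5 :> R by ring.
rewrite powRM //.
have := powR_ge0 2 (1765%:R / 478%:R : R).
move: (2 `^ _) (5 `^ _) x1 y1 => x y x1 y1 x0.
have : 0 <= (4693%:R / 363%:R - x) * (x + 4693%:R / 363%:R).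
  by apply: mulr_ge0; lra.
by lra.
Qed.

Lemma f_cond7 (q : R) : 41%:R / 10%:R <= q -> f_cond q 7.
Proof.
move=> hq; apply: (@f_cond_mono (41%:R / 10%:R)); [lra|lra|lra|].
have x1 : 1714%:R / 100%:R <= 2%:R `^ (41%:R / 10%:R) :> R.
  by apply: powR_rat_ge; [by []|by []|vm_compute].
have y1 : 904%:R / 10%:R <= 3%:R `^ (41%:R / 10%:R) :> R.
  by apply: powR_rat_ge; [by []|by []|vm_compute].
have z1 : 5%:R `^ (41%:R / 10%:R) <= 3671%:R / 5%:R :> R.
  by apply: powR_rat_le; [by []|by []|vm_compute].
rewrite /f_cond; have -> : 7 - 2 = 5 :> R by ring.
have -> : 7 - 1 = 2 * 3 :> R by ring.
rewrite powRM //.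
move: (2 `^ _) (3 `^ _) (5 `^ _) x1 y1 z1 => x y z x1 y1 z1.
(* Makes the bound on 6^q - 5 * 2^q = xy - 5x linear in y. *)
have : 0 <= (x - 1714%:R / 100%:R) * (y - 5) by apply: mulr_ge0; lra.
by lra.
Qed.

Lemma f_cond8 (q : R) : 47%:R / 10%:R <= q -> f_cond q 8.
Proof.
move=> hq; apply: (@f_cond_mono (47%:R / 10%:R)); [lra|lra|lra|].
have x1 : 2%:R `^ (47%:R / 10%:R) <= 26%:R / 1%:R :> R.
  by apply: powR_rat_le; [by []|by []|vm_compute].
have y1 : 3%:R `^ (47%:R / 10%:R) <= 175%:R / 1%:R :> R.
  by apply: powR_rat_le; [by []|by []|vm_compute].
have z1 : 930%:R * 10%:R <= 7%:R `^ (47%:R / 10%:R) :> R.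
  rewrite -natrM -[X in X%:R <= _]/(9300%N) -[leLHS]divr1.
  by apply: (@powR_rat_ge 9300 1); [by []|by []|vm_compute].
rewrite /f_cond; have -> : 8 - 2 = 2 * 3 :> R by ring.
have -> : 8 - 1 = 7 :> R by ring.
rewrite powRM //.
have := powR_ge0 3 (47%:R / 10%:R : R).
have := powR_ge0 2 (47%:R / 10%:R : R).
move: (2 `^ _) (3 `^ _) (7 `^ _) x1 y1 z1 => x y z x1 y1 z1 x0 y0.
have : x * y <= 26%:R * 175%:R by apply: ler_pM; lra.
by lra.
Qed.
End PowerBounds.

(** * Bounds on log 2 and the ceiling estimate *)

Section LogBounds.
Variable R : realType.

Lemma expR_le_inv (x : R) n : (0 < n)%N -> x < n%:R ->
  expR x <= ((1 - x / n%:R) ^+ n)^-1.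
Proof.
move=> n0 xn; have n0R : 0 < n%:R :> R by rewrite ltr0n.
have y0 : 0 < 1 - x / n%:R by rewrite subr_gt0 ltr_pdivrMr // mul1r.
rewrite -[x in leLHS]opprK expRN lef_pV2 ?posrE ?exprn_gt0 ?expR_gt0 //.
have -> : - x = n%:R * (- (x / n%:R)) by field; rewrite gt_eqF.
by rewrite expRM_natl lerXn2r ?nnegrE ?expR_ge0 ?(ltW y0) // expR_ge1Dx.
Qed.

(** The constant is chosen so that 6 * 41/60 = 4.1, the exponent from which n = 7 is verified. The
    proof bounds (1 - 41/1920)^32 below by 1/2 through five squarings. *)
Lemma ln2_ge : 41%:R / 60%:R <= ln 2 :> R.
Proof.
rewrite -ler_expR lnK ?posrE //.
have h : 41%:R / 60%:R < 32%:R :> R by lra.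
apply: le_trans (expR_le_inv (isT : 0 < 32)%N h) _.
rewrite invf_ple ?posrE //; last by rewrite exprn_gt0 //; lra.
have -> : 1 - 41%:R / 60%:R / 32%:R = 1879%:R / 1920%:R :> R by field.
have : 97864%:R / 100000%:R <= 1879%:R / 1920%:R :> R by lra.
move: (1879%:R / 1920%:R : R) => y y0.
have -> : y ^+ 32 = (y ^+ 16) ^+ 2 by rewrite -exprM.
have -> : y ^+ 16 = (y ^+ 8) ^+ 2 by rewrite -exprM.
have -> : y ^+ 8 = (y ^+ 4) ^+ 2 by rewrite -exprM.
have -> : y ^+ 4 = (y ^+ 2) ^+ 2 by rewrite -exprM.
have sq (c x z : R) : 0 <= c -> c <= x -> z <= c ^+ 2 -> z <= x ^+ 2.
  by move=> c0 cx /le_trans; apply; rewrite lerXn2r ?nnegrE // (le_trans c0).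
apply: (sq (7072%:R / 10000%:R)); [lra| |lra].
apply: (sq (8410%:R / 10000%:R)); [lra| |lra].
apply: (sq (9171%:R / 10000%:R)); [lra| |lra].
apply: (sq (9577%:R / 10000%:R)); [lra| |lra].
by apply: (sq (97864%:R / 100000%:R)); lra.
Qed.

Lemma ln2_le : ln 2 <= 73%:R / 100%:R :> R.
Proof.
rewrite -ler_expR lnK ?posrE //.
have := expR_ge1Dx (73%:R / 800%:R : R).
have -> : 73%:R / 100%:R = 8%:R * (73%:R / 800%:R) :> R by field.
rewrite (expRM_natl 8) => h.
move: (expR _) h => E h.
apply: (@le_trans _ _ ((1 + 73%:R / 800%:R) ^+ 8)); first by lra.
by apply: lerXn2r (h); rewrite nnegrE; lra.
Qed.

(** The function ln(1 - y) + y + y^2/2 vanishes at 0 and has derivative -y^2 / (1 - y). *)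
Lemma one_sub_le_expR (x : R) : 0 <= x -> x < 1 ->
  1 - x <= expR (- (x + x ^+ 2 / 2)).
Proof.
move=> x0 x1; pose k (y : R) := ln (1 - y) + (y + y * y / 2).
have dk y : 0 <= y <= x -> is_derive y 1 k (- (y ^+ 2 / (1 - y))).
  move=> /andP[y0 yx]; have z0 : 0 < 1 - y by lra.
  have d1 : is_derive y 1 (fun z : R => 1 - z) (-1).
    apply: (is_derive_eq (is_deriveB (is_derive_cst (1 : R) y 1) (is_derive_id y 1))).
    by rewrite sub0r.
  have d2 : is_derive y 1 (fun z : R => ln (1 - z)) ((1 - y)^-1 * -1).
    have := @is_derive1_comp R (fun z : R => ln z) (fun z : R => 1 - z) y _ _ (is_derive1_ln z0) d1.
    exact.
  have d3 := is_deriveM (is_deriveM (is_derive_id y 1) (is_derive_id y 1)) (is_derive_cst (2^-1 : R) y 1).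
  apply: (is_derive_eq (is_deriveD d2 (is_deriveD (is_derive_id y 1) d3))).
  by rewrite /GRing.scale /=; field; rewrite gt_eqF.
suff : k x <= 0.
  rewrite /k => h; rewrite -[leLHS]lnK ?posrE ?subr_gt0 // ler_expR; lra.
move: x0; rewrite le_eqVlt => /orP[/eqP <-|x0].
  by rewrite /k subr0 ln1; lra.
have [c [c0 cx E]] := MVT_is_derive x0 dk.
have : k 0 = 0 by rewrite /k subr0 ln1; lra.
have : 0 <= c ^+ 2 / (1 - c) * (x - 0).
  by rewrite mulr_ge0 ?divr_ge0 ?sqr_ge0 //; lra.
by move: E; lra.
Qed.

Lemma pow2_ge (m : nat) : (8 <= m)%N -> (3 * m ^ 2 <= 2 ^ m)%N.
Proof.
elim: m => // k IH; rewrite leq_eqVlt => /orP[/eqP <- //|k8].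
by have := IH k8; rewrite [(2 ^ k.+1)%N]expnS; nia.
Qed.

(** With m = n - 1, [base] leaves a share m^q / (3m + 1) of m^q free after 2 (m - 1)^q, and [pow2]
    shows that it covers (m - 1) 2^q. *)
Lemma f_cond_large (n : nat) (q : R) : (9 <= n)%N -> (n%:R - 1) * ln 2 <= q ->
  f_cond q n%:R.
Proof.
case: n => // k k8; rewrite -natr1 addrK => hq.
set m : R := k%:R in hq *.
have m8 : 8 <= m by rewrite (ler_nat R 8).
have l2 := ln2_ge.
have m0 : 0 < m by lra.
have q0 : 0 < q by apply: lt_le_trans hq; rewrite mulr_gt0 //; lra.
rewrite /f_cond -[X in _ <= X]addrA addrK.
have -> : m + 1 - 2 = m - 1 by ring.
have pow2 : 3 * m ^+ 2 <= (m / 2) `^ q.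
  apply: (@le_trans _ _ (2 ^+ k)).
    by rewrite /m -!natrX -natrM ler_nat pow2_ge.
  rewrite /powR gt_eqF ?divr_gt0 //.
  have -> : 2 ^+ k = expR (m * ln 2) by rewrite expRM_natl lnK ?posrE.
  rewrite ler_expR; apply: le_trans hq _; rewrite ler_peMr ?(ltW q0) //.
  have e4 : expR 1 <= 4 :> R.
    have h : 1 < 2%:R :> R by lra.
    apply: le_trans (expR_le_inv (isT : 0 < 2)%N h) _.
    by rewrite invf_ple ?posrE //; lra.
  rewrite -ler_expR lnK ?posrE ?divr_gt0 //; lra.
have base : 2 * ((m - 1) / m) `^ q <= 3 * m / (3 * m + 1).
  have mi0 : 0 < m^-1 by rewrite invr_gt0.
  have mi1 : m^-1 < 1 by rewrite invf_lt1 //; lra.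
  have h := one_sub_le_expR (ltW mi0) mi1.
  have -> : (m - 1) / m = 1 - m^-1 by field; rewrite gt_eqF.
  have : (1 - m^-1) `^ q <= expR (- (m^-1 + m^-1 ^+ 2 / 2)) `^ q.
    by apply: ge0_ler_powR; rewrite ?nnegrE ?expR_ge0 ?(ltW q0) //; lra.
  rewrite -expRM => {}h.
  (* From q >= m ln 2 the exponent is at least ln 2 + ln 2 / (2m) in absolute value, and ln 2 >=
     2/3. *)
  have h2 : expR (- (m^-1 + m^-1 ^+ 2 / 2) * q) <= expR (- ln 2) * expR (- (3 * m)^-1).
    rewrite -expRD ler_expR.
    have : m^-1 * (m * ln 2) <= m^-1 * q by rewrite ler_pM2l.
    rewrite mulrA mulVf ?gt_eqF // mul1r => h1.
    have : m^-1 / 2 * ln 2 <= m^-1 / 2 * (m^-1 * q) by rewrite ler_wpM2l //; lra.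
    have : m^-1 / 2 * (2 / 3) <= m^-1 / 2 * ln 2 by rewrite ler_wpM2l //; lra.
    by rewrite invfM; lra.
  have h3 : expR (- (3 * m)^-1) <= 3 * m / (3 * m + 1).
    have p1 : 0 < 3 * m by lra.
    have p2 : 0 < 3 * m + 1 by lra.
    rewrite expRN -[leRHS]invf_div lef_pV2 ?posrE ?expR_gt0 ?divr_gt0 //.
    have -> : (3 * m + 1) / (3 * m) = 1 + (3 * m)^-1 by field; rewrite gt_eqF.
    exact: expR_ge1Dx.
  move: h2; rewrite expRN lnK ?posrE // => h2.
  by lra.
have Mq : 0 < m `^ q by exact: powR_gt0.
have T : 0 < 2 `^ q :> R by exact: powR_gt0.
move: base; rewrite powR_div; [|lra|lra].
move: pow2; rewrite powR_div; [|lra|lra].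
rewrite ler_pdivlMr // => A.
have p2 : 0 < 3 * m + 1 by lra.
rewrite mulrA ler_pdivrMr // mulrAC ler_pdivlMr // => B.
have h1 : (m - 1) * (3 * m + 1) * 2 `^ q <= m `^ q.
  by apply: le_trans A; rewrite ler_pM2r //; lra.
rewrite -(ler_pM2r p2).
have : 0 <= m * (3 * m + 1) by rewrite mulr_ge0 //; lra.
move: (m `^ q) ((m - 1) `^ q) (2 `^ q) A B h1 => x y z A B h1.
by lra.
Qed.

Lemma f_cond_ceil (q : R) (n : nat) : 369247%:R / 10 ^+ 5 <= q ->
  Num.ceil (q / ln 2) = n%:Z -> (6 <= n)%N /\ f_cond q n%:R.
Proof.
move=> hq nE; have l1 := ln2_ge; have l2 := ln2_le.
have l0 : 0 < ln 2 :> R by lra.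
have := ceil_itv (q / ln 2); rewrite nE => /andP[].
rewrite ltr_pdivlMr // ler_pdivrMr // -[n%:Z%:~R]/(n%:R) intrB => lo hi.
(* Because 5 ln 2 <= 3.65 < 3.69247 <= q. *)
have n6 : (6 <= n)%N.
  rewrite leqNgt; apply/negP => n5; have : n%:R <= 5 :> R by rewrite (ler_nat R n 5).
  move=> n5R; have : n%:R * ln 2 <= 5 * ln 2 :> R by rewrite ler_pM2r.
  by lra.
split=> //; move: lo; rewrite -[1%:~R]/1 -[n%:~R]/(n%:R) => lo.
have [n9|n9] := leqP 9 n; first by apply: f_cond_large => //; lra.
have [->|n6'] := eqVneq n 6; first exact: f_cond6.
have [nE7|n7'] := eqVneq n 7.
  by move: lo; rewrite nE7 => lo; apply: f_cond7; lra.
have nE8 : n = 8%N by lia.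
by move: lo; rewrite nE8 => lo; apply: f_cond8; lra.
Qed.
End LogBounds.

(** * Degrees in l_p *)

Section LpDegrees.
Variables (R : realType) (p : R) (d : nat) (p1 : 1 < p).
Hypothesis p2 : p < 2.
Let q := p / (p - 1).
Let X : normedModType R := lp (ltW p1) d.

Let qE : q * (p - 1) = p.
Proof. by rewrite divfK // gt_eqF // subr_gt0. Qed.

Let q2 : 2 < q.
Proof. by have := subr_gt0 1 p; rewrite p1 => h; rewrite ltr_pdivlMr //; move: p2; lra. Qed.

(* The first-order form of [SMT_exchange], with the new Steiner point on the
   ray from [x] in direction [w]. *)
Lemma SMT_normal_bound (S V : {fset X}) (e : rel V) (x : V) (A : {set V})
    (w : 'rV[R]_d) : is_SMT S e -> (forall y, y \in A -> e x y) ->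
  \sum_(y in A) dot (normal p (val y - val x : 'rV[R]_d)) w <= pnorm p w.
Proof.
move=> smt Ax; apply: (normal_dual_bound p1 p2) => [y yA|t].
  rewrite -[pnorm p _]/(`|val y - val x : X|) normr_gt0 subr_eq0.
  have [_ [_ eirr _ _ _] _] := smt.
  by apply: contraTneq (Ax y yA) => /val_inj ->; rewrite eirr.
have := SMT_exchange (val x + (t *: (w : X))) smt Ax.
rewrite addrAC subrr add0r => h.
have nE (v : X) : `|v| = pnorm p (v : 'rV[R]_d) by [].
suff -> : \sum_(y in A) (pnorm p (val y - val x - t *: w) - pnorm p (val y - val x)) =
    \sum_(y in A) (`|val y - (val x + t *: (w : X))| - `|val y - val x|).
  by rewrite -[pnorm p (t *: w)]/(`|t *: (w : X)|).
by apply: eq_bigr => y _; rewrite !nE opprD addrA.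
Qed.

(** The normals at the differences to the neighbours form a family with bounded subset sums. As [x]
    is any point of the tree, given points and Steiner points are treated together. *)
Lemma SMT_degree_le (S V : {fset X}) (e : rel V) (x : V) : is_SMT S e ->
  (degree e x <= d.+1)%N /\ (degree e x)%:R <= 2 `^ q.
Proof.
move=> smt; have [_ [_ eirr _ _ _] _] := smt.
pose nb := [pred y | e x y].
pose a (i : 'I_#|nb|) : 'rV[R]_d := val (enum_val i) - val x.
have a0 i : 0 < pnorm p (a i).
  rewrite -[pnorm p _]/(`|val (enum_val i) - val x : X|) normr_gt0 subr_eq0.
  have := enum_valP i; rewrite inE.
  by apply: contraTneq => /val_inj ->; rewrite eirr.
have sub (A : {set 'I_#|nb|}) w : \sum_(i in A) dot (normal p (a i)) w <= pnorm p w.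
  have inj : {in A &, injective (@enum_val _ nb)} by move=> i j _ _; exact: enum_val_inj.
  have := @SMT_normal_bound S V e x ([set enum_val i | i in A]) w smt.
  rewrite big_imset //; apply => y /imsetP[i _ ->].
  by have := enum_valP i; rewrite inE.
have ua i : dot (normal p (a i)) (a i) = pnorm p (a i) by exact: (dot_normal p1).
split; first exact: (family_size_dim p1 p2 qE sub a0 ua).
exact: (family_size_powR p1 p2 qE sub a0 ua).
Qed.

(** The leaves of the star are the unit vectors dual to the simplex functionals; as these sum to
    zero, the centre may be a Steiner point too. *)
Lemma lp_degrees (n : nat) : (2 <= n)%N -> (n <= d)%N ->
    simplex_defect q n 2 <= simplex_defect q n 1 ->
  vertex_degree X n /\ steiner_degree X n.
Proof.
move=> n2 nd h.
have hmax k : (k <= n)%N -> simplex_defect q n k <= simplex_defect q n 1.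
  exact: simplex_defect_max.
pose u := @simplex R q n d.
pose phi i (w : X) := dot (u i) (w : 'rV[R]_d).
pose a i : X := dual q (u i).
have phiB i v w : phi i (v - w) = phi i v - phi i w by exact: dotBr.
have phile (A : {set 'I_n}) w : \sum_(i in A) phi i w <= `|w|.
  exact: (simplex_subset p1 p2 qE n2 nd hmax).
have a1 i : `|a i| = 1 by exact: (pnorm_simplex p1 p2 qE n2 nd).
have phia i : phi i (a i) = 1 by exact: (simplex_dual p1 p2 qE n2 nd).
split; first exact: (star_vertex_degree phiB phile a1 phia).
apply: (star_steiner_degree phiB phile a1 phia); first by lia.
move=> w; exact: simplex_sum0.
Qed.
End LpDegrees.

Theorem theorem9 (R : realType) :
  (forall (p : R) (d : nat) (p1 : 1 < p), p < 2 -> (3 <= d)%N ->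
     let X : normedModType R := lp (ltW p1) d in
     let q := p / (p - 1) in
     exists s v f : nat,
       [/\ is_s X s, is_v X v, is_f q f,
           (minn d f <= s)%N /\ s%:R <= Num.min d.+1%:R (2 `^ q)
         & (minn d f <= v)%N /\ v%:R <= Num.min d.+1%:R (2 `^ q)]) /\
  (forall q : R, 2 < q ->
     exists f : nat,
       [/\ is_f q f,
           (3 <= f)%N,
           321067%:R / 10 ^+ 5 <= q -> (4 <= f)%N,
           340093%:R / 10 ^+ 5 <= q -> (5 <= f)%N
         & 369247%:R / 10 ^+ 5 <= q -> Num.ceil (q / ln 2) <= f%:Z]).
Proof.
split=> [p d p1 p2 d3 X q|q q2].
  have q2 : 2 < q.
    by have := subr_gt0 1 p; rewrite p1 => h; rewrite /q ltr_pdivlMr //; lra.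
  have [f ff f3] := exists_f q2.
  have [[f2 fc] fmax] := ff.
  (* The inequality holds at f and passes down to this n, while n <= d leaves room for the
     simplex. *)
  pose n := minn d f.
  have [nv ns] : vertex_degree X n /\ steiner_degree X n.
    apply: lp_degrees => //; [by rewrite /n; lia|exact: geq_minl|].
    apply: (@simplex_defect_closed R q q2 n f); [by rewrite /n; lia|exact: geq_minr|].
    by rewrite simplex_defect_le12.
  have degv m : vertex_degree X m -> (m <= d.+1)%N /\ m%:R <= 2 `^ q.
    by move=> [S [V [e [x [smt _ ->]]]]]; exact: (@SMT_degree_le R p d p1 p2 S V e x smt).
  have degs m : steiner_degree X m -> (m <= d.+1)%N /\ m%:R <= 2 `^ q.
    by move=> [S [V [e [x [smt _ ->]]]]]; exact: (@SMT_degree_le R p d p1 p2 S V e x smt).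
  have bound m : (m <= d.+1)%N /\ m%:R <= 2 `^ q ->
      m%:R <= Num.min d.+1%:R (2 `^ q) :> R.
    by move=> [md mq]; rewrite le_min ler_nat md.
  have [v vv] := exists_largest nv (fun m h => proj2 (degv m h)).
  have [s ss] := exists_largest ns (fun m h => proj2 (degs m h)).
  exists s, v, f; split=> //; split.
  - exact: (proj2 ss).
  - by apply: bound; apply: degs; exact: (proj1 ss).
  - exact: (proj2 vv).
  - by apply: bound; apply: degv; exact: (proj1 vv).
have [f ff f3] := exists_f q2; exists f; have [_ fmax] := ff.
have le_f n : (2 <= n)%N -> f_cond q n%:R -> (n <= f)%N by move=> n2 h; apply: fmax.
split=> // hq.
- by apply: le_f => //; exact: f_cond4.
- by apply: le_f => //; exact: f_cond5.
have c0 : 0 <= q / ln 2.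
  have l := @ln2_ge R; rewrite divr_ge0 //; lra.
have [n nE] : exists n : nat, Num.ceil (q / ln 2) = n%:Z.
  exists `|Num.ceil (q / ln 2)|%N; rewrite gez0_abs // -(ler_int R) .
  exact: le_trans c0 (Num.Theory.ceil_ge _).
have [n6 h] := f_cond_ceil hq nE.
by rewrite nE lez_nat; apply: le_f => //; lia.
Qed.
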